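(* Among the sixteen lattices $U+A_2$, $U(2)+A_2$, $U+A_2+D_4$, $U(2)+A_2+D_4$, $U+E_6(2)$, $U(2)+E_6(2)$, $U+A_2+E_8$, $U(2)+A_2+E_8$, $U+A_2+2D_4$, $U(2)+A_2+2D_4$, $U+A_2+E_8(2)$, $U(2)+A_2+E_8(2)$, $U+A_2+D_4+E_8$, $U(2)+A_2+D_4+E_8$, $U+A_2+2E_8$, $U(2)+A_2+2E_8$ there are exactly 4 chiral lattices: ${U+A_2}$, ${U(2)+A_2}$, ${U+A_2+D_4}$, and ${U+A_2+E_8}$. All the others are achiral.
   Context: These sixteen lattices are exactly the lattices $\mathbb M_+^0(X)$ (invariant part of $H^4$ of a real non-singular cubic fourfold $X$, orthogonal to the polarization) for the coarse deformation classes with even 2-primary discriminant form. $U$ is the hyperbolic plane, $A_n,D_n,E_n$ the positive definite root lattices, $\mathbb L(2)$ the lattice with form multiplied by 2, $+$ orthogonal sum. For such a lattice $\mathbb L$ (even, signature $(n,1)$, $\operatorname{discr}_3\mathbb L=\mathbb Z/3$, $\operatorname{discr}_2$ of period 2), let $W$ be the group generated by reflections in 2-roots ($v^2=2$) and 6-roots ($v^2=6$, $v\cdot\mathbb L\subset3\mathbb Z$); cells $P$ are its fundamental chambers in the hyperbolic space, each lifting to $\pm P^\#$ in the double cover. An automorphism is $P$-direct if it preserves $P^\#$, $\mathbb Z/3$-reversing if it acts as $-\operatorname{id}$ on $\operatorname{discr}_3\mathbb L$. $\mathbb L$ is achiral if it has an automorphism $\mathbb Z/3$-reversing and $P$-direct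 for some cell $P$, chiral otherwise. *)

(* Defs.v *)
From HB Require Import structures.
From mathcomp Require Import all_boot all_order all_algebra.
From mathcomp Require Import all_classical all_reals all_analysis.
From mathcomp Require Import Rstruct Rstruct_topology.
Set Implicit Arguments. Unset Strict Implicit. Unset Printing Implicit Defensive.
Import Order.TTheory GRing.Theory Num.Theory.
Local Open Scope classical_set_scope.
Local Open Scope ring_scope.

Notation RR := Rdefinitions.R.

(* A lattice of rank n is Z^n (row vectors) with an integer Gram matrix G:
   b(x,y) = x *m G *m y^T.  Automorphisms act on row vectors: x |-> x *m g. *)

Definition cartan n (e : 'I_n -> 'I_n -> bool) : 'M[int]_n :=
  \matrix_(i, j) (if i == j then 2 else if e i j || e j i then -1 else 0).

Definition edges n (s : seq (nat * nat)) : 'I_n -> 'I_n -> bool :=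
  fun i j => (nat_of_ord i, nat_of_ord j) \in s.

(* Bourbaki numbering, shifted to 0-based *)
Definition A2 : 'M[int]_2 := cartan (@edges 2 [:: (0,1)]%N).
Definition D4 : 'M[int]_4 := cartan (@edges 4 [:: (1,0); (1,2); (1,3)]%N).
Definition E6 : 'M[int]_6 :=
  cartan (@edges 6 [:: (0,2); (2,3); (3,4); (4,5); (1,3)]%N).
Definition E8 : 'M[int]_8 :=
  cartan (@edges 8 [:: (0,2); (2,3); (3,4); (4,5); (5,6); (6,7); (1,3)]%N).
Definition U : 'M[int]_2 := \matrix_(i, j) (if i == j then 0 else 1).

Definition scale2 n (A : 'M[int]_n) : 'M[int]_n := A *+ 2.
Definition osum m n (A : 'M[int]_m) (B : 'M[int]_n) : 'M[int]_(m + n) :=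
  block_mx A 0 0 B.

Definition bR n (G : 'M[int]_n) (x y : 'rV[RR]_n) : RR :=
  (x *m map_mx intr G *m y^T) 0 0.
Definition bZ n (G : 'M[int]_n) (x y : 'rV[int]_n) : int :=
  (x *m G *m y^T) 0 0.

Definition root_vec n (G : 'M[int]_n) (v : 'rV[int]_n) : Prop :=
  bZ G v v = 2 \/
  (bZ G v v = 6 /\ forall w : 'rV[int]_n, (3 %| bZ G v w)%Z).

(* the cone of negative vectors minus all mirrors of W (reflections in roots);
   its connected components are exactly the lifts P^# of the cells P *)
Definition cone_minus_mirrors n (G : 'M[int]_n) : set 'rV[RR]_n :=
  [set x | bR G x x < 0 /\
           forall v, root_vec G v -> bR G x (map_mx intr v) != 0].

Definition lifted_cell n (G : 'M[int]_n) (P : set 'rV[RR]_n) : Prop :=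
  exists2 x, cone_minus_mirrors G x & P = connected_component (cone_minus_mirrors G) x.

Definition isometry n (G : 'M[int]_n) (g : 'M[int]_n) : Prop :=
  g *m G *m g^T = G.

Definition direct n (g : 'M[int]_n) (P : set 'rV[RR]_n) : Prop :=
  (fun x => x *m map_mx intr g) @` P = P.

Definition integral n (x : 'rV[rat]_n) : Prop :=
  exists z : 'rV[int]_n, x = map_mx intr z.
(* x in L^*  :  x . y in Z for all y in L *)
Definition in_dual n (G : 'M[int]_n) (x : 'rV[rat]_n) : Prop :=
  integral (x *m map_mx intr G).
(* g acts as -id on discr_3 L = 3-primary part of L^*/L *)
Definition Z3_reversing n (G : 'M[int]_n) (g : 'M[int]_n) : Prop :=
  forall x : 'rV[rat]_n, in_dual G x -> (exists k : nat, integral (x *+ (3 ^ k))) ->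
    integral (x *m map_mx intr g + x).

Definition achiral n (G : 'M[int]_n) : Prop :=
  exists g : 'M[int]_n, [/\ isometry G g, Z3_reversing G g &
    exists P, lifted_cell G P /\ direct g P].
Definition chiral n (G : 'M[int]_n) : Prop := ~ achiral G.

(* Main.v *)
Require Import Defs.
From HB Require Import structures.
From mathcomp Require Import all_boot all_order all_algebra.
From mathcomp Require Import all_classical all_reals all_analysis.
From mathcomp Require Import Rstruct Rstruct_topology.
From mathcomp Require Import polyrcf.
From mathcomp Require Import zify ring lra.
Set Implicit Arguments. Unset Strict Implicit. Unset Printing Implicit Defensive.
Import Order.TTheory GRing.Theory Num.Theory.
Import numFieldNormedType.Exports.
Local Open Scope classical_set_scope.
Local Open Scope ring_scope.

(* A lattice is achiral as soon as it has an involution that acts as -1 on the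
   3-primary part of the discriminant and whose coinvariant lattice K contains no
   2-roots and no 6-roots: a generic point of the fixed subspace then lies on no
   mirror, so that its cell is preserved.  For all the achiral lattices K can be
   chosen isomorphic to E6(2), whose norms are divisible by 4.

   Let conversely g be an isometry of U(k) + A2 + N, with N = 0, D4 or E8, that
   preserves a lifted cell, x a point of this cell and (e, f) the standard basis of
   U(k).  Among the images of e under isometries choose the one closest to x; after
   conjugation it is e.  Then no mirror separates e from x, hence none separates x,
   or x g, from e g.  If e g is not e, write it as a e + b f + l with b < 0; every
   2-root c e + f + m forces |m - l / b|^2 >= 2.  This is impossible because the
   squared covering radius is less than 1 for A2 and at most 1 for N; in U(2) + A2
   only the m in A2 outside 2 A2 occur, which leaves the single exception
   e g = - f, undone by the reflection exchanging e and - f.  So g fixes e, and it acts on the hyperplanes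
   transverse to e while preserving an alcove of the affine Weyl group of type G2
   attached to A2.  The alcove has no symmetries, so g acts trivially on the
   discriminant of A2 and cannot reverse it. *)

Local Notation rmx := (map_mx (intr : int -> RR)).
Local Notation isometry := Defs.isometry.
Local Notation integral := Defs.integral.

(** * Gram forms *)

Section GramForm.
Variables (R : comNzRingType) (n : nat) (M : 'M[R]_n).
Implicit Types x y : 'rV[R]_n.

Definition gram_form x y : R := (x *m M *m y^T) 0 0.

Lemma gram_form_is_bilinear : bilinear_for *%R *%R gram_form.
Proof.
split=> [z|z] a x y /=; rewrite /gram_form.
  by rewrite mulmxDl -!scalemxAl mulmxDl -scalemxAl !mxE.
by rewrite linearD linearZ /= mulmxDr -scalemxAr !mxE.
Qed.

HB.instance Definition _ := bilinear_isBilinear.Build R 'rV[R]_n 'rV[R]_n R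
  *%R *%R gram_form gram_form_is_bilinear.

Lemma gram_formC x y : M^T = M -> gram_form x y = gram_form y x.
Proof.
move=> symM; rewrite /gram_form; have -> : x *m M *m y^T = (y *m M *m x^T)^T.
  by rewrite !trmx_mul trmxK symM mulmxA.
by rewrite mxE.
Qed.

Lemma gram_form_isometry (g : 'M[R]_n) x y :
  g *m M *m g^T = M -> gram_form (x *m g) (y *m g) = gram_form x y.
Proof. by move=> gM; rewrite /gram_form trmx_mul -{2}gM !mulmxA. Qed.

End GramForm.

Lemma gram_form_block (R : comNzRingType) m n (A : 'M[R]_m) (B : 'M[R]_n) x y x' y' :
  gram_form (block_mx A 0 0 B) (row_mx x y) (row_mx x' y') =
  gram_form A x x' + gram_form B y y'.
Proof.
rewrite /gram_form mul_row_block !mulmx0 addr0 add0r.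
by rewrite tr_row_mx mul_row_col mxE.
Qed.

HB.instance Definition _ n (G : 'M[int]_n) := bilinear_isBilinear.Build
  RR 'rV[RR]_n 'rV[RR]_n RR *%R *%R (bR G) (gram_form_is_bilinear (rmx G)).

HB.instance Definition _ n (G : 'M[int]_n) := bilinear_isBilinear.Build
  int 'rV[int]_n 'rV[int]_n int *%R *%R (bZ G) (gram_form_is_bilinear G).

Lemma map_intr_mx_inj (R : numDomainType) m n :
  injective (map_mx intr : 'M[int]_(m, n) -> 'M[R]_(m, n)).
Proof.
move=> A B /matrixP AB; apply/matrixP => i j.
by have := AB i j; rewrite !mxE => /intr_inj.
Qed.

Lemma rmx_eq0 m n (A : 'M[int]_(m, n)) : (rmx A == 0) = (A == 0).
Proof. by rewrite -(map_mx0 intr) (inj_eq (@map_intr_mx_inj RR m n)). Qed.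

Lemma rmx_mulmxKV n g (x : 'rV[RR]_n) : g \in unitmx ->
  x *m rmx (invmx g) *m rmx g = x.
Proof. by move=> gu; rewrite -mulmxA -map_mxM mulVmx // map_mx1 mulmx1. Qed.

Section IntegralForms.
Variables (n : nat) (G : 'M[int]_n).
Implicit Types (x y : 'rV[RR]_n) (u v : 'rV[int]_n) (g h : 'M[int]_n).

Lemma bR_rmx u v : bR G (rmx u) (rmx v) = (bZ G u v)%:~R.
Proof. by rewrite /bR /bZ map_trmx -!map_mxM mxE. Qed.

Lemma bRZl a x y : bR G (a *: x) y = a * bR G x y.
Proof. exact: linearZl_LR. Qed.

Lemma bRZr a x y : bR G x (a *: y) = a * bR G x y.
Proof. exact: linearZr_LR. Qed.

Lemma bRC x y : G^T = G -> bR G x y = bR G y x.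
Proof. by move=> symG; apply: gram_formC; rewrite map_trmx symG. Qed.

Lemma bZC u v : G^T = G -> bZ G u v = bZ G v u.
Proof. exact: gram_formC. Qed.

Lemma bR_isometry g x y : isometry G g ->
  bR G (x *m rmx g) (y *m rmx g) = bR G x y.
Proof. by move=> gG; apply: gram_form_isometry; rewrite map_trmx -!map_mxM gG. Qed.

Lemma bZ_isometry g u v : isometry G g -> bZ G (u *m g) (v *m g) = bZ G u v.
Proof. exact: gram_form_isometry. Qed.

Lemma isometry_of_bZ g :
  (forall u v, bZ G (u *m g) (v *m g) = bZ G u v) -> isometry G g.
Proof.
have entryE (M : 'M[int]_n) i j :
    gram_form M (delta_mx 0 i) (delta_mx 0 j) = M i j.
  by rewrite /gram_form trmx_delta -rowE -colE !mxE.
move=> gG; apply/matrixP => i j; rewrite -entryE -[RHS]entryE.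
by have := gG (delta_mx 0 i) (delta_mx 0 j); rewrite /bZ /gram_form trmx_mul !mulmxA.
Qed.

Lemma isometry1 : isometry G 1%:M.
Proof. by rewrite /Defs.isometry trmx1 mulmx1 mul1mx. Qed.

Lemma isometryN g : isometry G g -> isometry G (- g).
Proof. by rewrite /Defs.isometry linearN /= mulmxN !mulNmx opprK. Qed.

Lemma isometryM g h : isometry G g -> isometry G h -> isometry G (g *m h).
Proof.
rewrite /isometry => gG hG.
by rewrite trmx_mul !mulmxA -(mulmxA g h G) -(mulmxA g (h *m G)) hG gG.
Qed.

Hypothesis detG : \det G != 0.

Lemma isometry_unitmx g : isometry G g -> g \in unitmx.
Proof.
move=> /(congr1 determinant); rewrite !det_mulmx det_tr mulrAC.
rewrite -[RHS]mul1r => /(mulIf detG) dgg.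
by rewrite unitmxE; apply/unitrPr; exists (\det g).
Qed.

Lemma isometryV g : isometry G g -> isometry G (invmx g).
Proof.
move=> gG; have gu := isometry_unitmx gG.
rewrite /isometry -{1}gG trmx_inv !mulmxA mulVmx // mul1mx -mulmxA.
by rewrite mulmxV ?mulmx1 // unitmx_tr.
Qed.

Lemma root_vec_isometry g v :
  isometry G g -> root_vec G v -> root_vec G (v *m g).
Proof.
move=> gG; have gu := isometry_unitmx gG.
case=> [v2|[v6 v3]]; [left | right]; rewrite bZ_isometry //; split=> // w.
by rewrite -[w](mulmxKV gu) bZ_isometry.
Qed.

End IntegralForms.

Lemma root_vec_norm_gt0 n (G : 'M[int]_n) r : root_vec G r -> 0 < bZ G r r.
Proof. by case=> [->|[-> _]]. Qed.

Lemma osum_sym m n (A : 'M[int]_m) (B : 'M[int]_n) :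
  A^T = A -> B^T = B -> (osum A B)^T = osum A B.
Proof. by move=> sA sB; rewrite /osum tr_block_mx sA sB !trmx0. Qed.

Lemma bZ_osum m n (A : 'M[int]_m) (B : 'M[int]_n) x y x' y' :
  bZ (osum A B) (row_mx x y) (row_mx x' y') = bZ A x x' + bZ B y y'.
Proof. exact: gram_form_block. Qed.

Lemma bR_osum m n (A : 'M[int]_m) (B : 'M[int]_n) x y x' y' :
  bR (osum A B) (row_mx x y) (row_mx x' y') = bR A x x' + bR B y y'.
Proof. by rewrite /bR /osum map_block_mx !map_mx0; exact: gram_form_block. Qed.

Lemma cartan_sym n (e : 'I_n -> 'I_n -> bool) : (cartan e)^T = cartan e.
Proof. by apply/matrixP => i j; rewrite !mxE eq_sym orbC. Qed.

Definition even_lattice n (M : 'M[int]_n) := forall v, (2 %| bZ M v v)%Z.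

Lemma even_lattice_diag n (M : 'M[int]_n) :
  M^T = M -> (forall i, (2 %| M i i)%Z) -> even_lattice M.
Proof.
move=> symM evM v; pose T : 'M[int]_n := \matrix_(i, j)
  (if (i < j)%N then M i j else if i == j then divz (M i i) 2 else 0).
have ME : M = T + T^T.
  apply/matrixP => i j; have := congr1 (fun A : 'M[int]_n => A i j) symM.
  rewrite mxE !mxE; have [ij|ij|/ord_inj <-] := ltngtP i j.
  - by rewrite -val_eqE /= gtn_eqF // addr0.
  - by rewrite -[i == j]val_eqE /= gtn_eqF // add0r.
  by rewrite eqxx; have := evM i; lia.
have bME : bZ M v v = gram_form T v v + gram_form T v v.
  rewrite {1}ME /bZ mulmxDr mulmxDl mxE; congr (_ + _).
  have -> : v *m T^T *m v^T = (v *m T *m v^T)^T.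
    by rewrite !trmx_mul trmxK mulmxA.
  by rewrite mxE.
by rewrite bME; apply/dvdzP; exists (gram_form T v v); ring.
Qed.

Lemma cartan_even n (e : 'I_n -> 'I_n -> bool) : even_lattice (cartan e).
Proof.
by apply: even_lattice_diag => [|i]; [exact: cartan_sym | rewrite mxE eqxx].
Qed.

(** * Positive definite forms *)

Section PositiveDefinite.
Variables (R : realFieldType) (n : nat) (M : 'M[R]_n).

Definition posdef := forall v : 'rV[R]_n, v != 0 -> 0 < gram_form M v v.

Hypothesis posM : posdef.

Lemma posdef_ge0 v : 0 <= gram_form M v v.
Proof. by have [->|/posM/ltW//] := eqVneq v 0; rewrite linear0l. Qed.

Lemma posdef_eq0 v : gram_form M v v = 0 -> v = 0.
Proof. by move=> vv; apply: contra_eq (vv) => /posM; rewrite vv ltxx. Qed.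

Lemma posdef_unitmx : M \in unitmx.
Proof.
rewrite -row_free_unit; apply: inj_row_free => v vM.
by apply: posdef_eq0; rewrite /gram_form vM mul0mx mxE.
Qed.

Hypothesis symM : M^T = M.

Lemma cauchy_schwarz x y :
  gram_form M x y ^+ 2 <= gram_form M x x * gram_form M y y.
Proof.
have [->|/posM yy] := eqVneq y 0; first by rewrite !linear0r expr0n.
have := posdef_ge0 (gram_form M y y *: x - gram_form M x y *: y).
rewrite linearBl !linearBr !linearZl_LR !linearZr_LR /= (gram_formC y x symM).
move: yy; move: (gram_form M y y) (gram_form M x y) (gram_form M x x) => Y B X Y0.
rewrite (_ : _ - _ = Y * (X * Y - B ^+ 2)); last by ring.
by rewrite pmulr_rge0 // subr_ge0.
Qed.

Lemma posdef_coord_bound D : exists E : R, forall v : 'rV[R]_n,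
  gram_form M v v <= D -> forall j, `|v 0 j| <= E.
Proof.
pose w j := (col j (invmx M))^T.
have wE v j : gram_form M v (w j) = v 0 j.
  by rewrite /gram_form trmxK colE mulmxA mulmxK ?posdef_unitmx // -colE mxE.
pose F := \sum_j gram_form M (w j) (w j).
exists (1 + D * F) => v vD j.
have D0 : 0 <= D := le_trans (posdef_ge0 v) vD.
have wF : gram_form M (w j) (w j) <= F.
  by rewrite /F (bigD1 j) //= lerDl sumr_ge0 // => i _; exact: posdef_ge0.
have {wF} vF : `|v 0 j| ^+ 2 <= D * F.
  rewrite real_normK ?num_real // -[v 0 j]wE.
  by apply: le_trans (cauchy_schwarz _ _) _; apply: ler_pM => //; exact: posdef_ge0.
by move: vF (normr_ge0 (v 0 j)); nra.
Qed.

End PositiveDefinite.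

(** * Lorentzian lattices *)

Section Lorentzian.
Variables (n : nat) (G : 'M[int]_n).
Implicit Types (x y z t u v : 'rV[RR]_n).

Definition lorentzian := G^T = G /\ exists2 t, bR G t t < 0 &
  forall z, bR G t z = 0 -> z != 0 -> 0 < bR G z z.

Hypothesis lorG : lorentzian.

Let bGC x y : bR G x y = bR G y x.
Proof. by case: lorG => symG _; exact: bRC. Qed.

Lemma timelike_orth_gt0 x z :
  bR G x x < 0 -> bR G x z = 0 -> z != 0 -> 0 < bR G z z.
Proof.
move=> xx xz z0; have [_ [t tt t_orth]] := lorG.
have [tz|tz] := eqVneq (bR G t z) 0; first exact: t_orth.
pose w := bR G t z *: x - bR G t x *: z.
have tw : bR G t w = 0 by rewrite linearBr /= !bRZr /= mulrC subrr.
have ww : 0 <= bR G w w.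
  by have [->|/(t_orth w tw)/ltW//] := eqVneq w 0; rewrite linear0l.
move: ww; rewrite /w linearBl !linearBr /= !bRZl !bRZr /= (bGC z x) xz.
have : 0 < bR G t z ^+ 2 by rewrite exprn_even_gt0.
by move=> *; nra.
Qed.

Lemma timelike_causal_neq0 x u :
  bR G x x < 0 -> bR G u u <= 0 -> u != 0 -> bR G x u != 0.
Proof.
move=> xx uu u0; apply/eqP => xu.
by have := timelike_orth_gt0 xx xu u0; rewrite ltNge uu.
Qed.

(* The combination of [u] and [v] orthogonal to the timelike vector [x] has
   nonnegative norm. *)
Lemma causal_le0 x u v : bR G x x < 0 -> bR G u u <= 0 -> bR G v v <= 0 ->
  bR G x u < 0 -> bR G x v < 0 -> bR G u v <= 0.
Proof.
move=> xx uu vv xu xv; pose w := bR G x v *: u - bR G x u *: v.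
have xw : bR G x w = 0 by rewrite linearBr /= !bRZr /= mulrC subrr.
have ww : 0 <= bR G w w.
  by have [->|/(timelike_orth_gt0 xx xw)/ltW//] := eqVneq w 0; rewrite linear0l.
move: ww; rewrite /w linearBl !linearBr /= !bRZl !bRZr /= (bGC v u).
move: xu xv uu vv; move: (bR G x u) (bR G x v) (bR G u u) (bR G v v) (bR G u v).
move=> a b U V c a0 b0 U0 V0 ww.
have ab : 0 < a * b by rewrite nmulr_rgt0.
have bU : b * (b * U) <= 0 by nra.
have aV : a * (a * V) <= 0 by nra.
by nra.
Qed.

Lemma timelike_causal_lt0 x y u : bR G x x < 0 -> bR G y y < 0 ->
  bR G u u <= 0 -> u != 0 -> bR G x y < 0 -> bR G x u < 0 -> bR G y u < 0.
Proof.
move=> xx yy uu u0 xy xu; rewrite lt_neqAle timelike_causal_neq0 //=.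
exact: causal_le0 xx (ltW yy) uu xy xu.
Qed.

Lemma timelike_lt0_of_causal x y u : bR G x x < 0 -> bR G y y < 0 ->
  bR G u u <= 0 -> bR G x u < 0 -> bR G y u < 0 -> bR G x y < 0.
Proof.
move=> xx yy uu xu yu.
have y0 : y != 0 by apply: contraTneq yy => ->; rewrite linear0l ltxx.
have xy := timelike_causal_neq0 xx (ltW yy) y0.
rewrite lt_neqAle xy leNgt; apply/negP => xy0.
have yy' : bR G (- y) (- y) <= 0 by rewrite linearNl linearNr opprK ltW.
have := causal_le0 xx yy' uu _ xu; rewrite linearNr linearNl oppr_lt0 oppr_le0.
by move=> /(_ xy0); rewrite leNgt yu.
Qed.

Lemma lorentzian_det_neq0 : \det G != 0.
Proof.
have [_ [t tt t_orth]] := lorG.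
rewrite -(intr_eq0 RR) -det_map_mx -unitfE -unitmxE -row_free_unit.
apply: inj_row_free => v vG.
have bv z : bR G v z = 0 by rewrite /bR vG mul0mx mxE.
apply/eqP; apply: contraT => /t_orth; rewrite bGC !bv ltxx; exact.
Qed.

(* The sign of the form is changed along the timelike vector [x]. *)
Definition majorant x : 'M[RR]_n :=
  rmx G - (2 / bR G x x) *: (rmx G *m x^T *m (x *m rmx G)).

Lemma majorantE x u v : gram_form (majorant x) u v =
  bR G u v - 2 / bR G x x * (bR G u x * bR G x v).
Proof.
rewrite /gram_form /majorant mulmxBr mulmxBl -scalemxAr -scalemxAl (mulmxA u).
rewrite -(mulmxA (u *m _)) (mulmxA u) [u *m _ *m _]mx11_scalar mul_scalar_mx.
by rewrite scalerA mxE [X in _ + X]mxE [X in - X]mxE -mulrA.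
Qed.

Lemma majorant_sym x : (majorant x)^T = majorant x.
Proof.
have [symG _] := lorG.
by rewrite /majorant linearB linearZ /= !trmx_mul !trmxK map_trmx symG mulmxA.
Qed.

Lemma majorant_posdef x : bR G x x < 0 -> posdef (majorant x).
Proof.
move=> xx v v0; rewrite majorantE (bGC v x).
have [s xv] : exists s, bR G x v = s * bR G x x.
  by exists (bR G x v / bR G x x); rewrite divfK // lt_eqF.
have [z vE xz] : exists2 z, v = s *: x + z & bR G x z = 0.
  exists (v - s *: x); first by rewrite addrC subrK.
  by rewrite linearBr /= bRZr /= xv subrr.
have vv : bR G v v = s ^+ 2 * bR G x x + bR G z z.
  have zv : bR G z v = bR G z z.
    by rewrite vE linearDr /= bRZr /= (bGC z x) xz mulr0 add0r.
  by rewrite {1}vE linearDl /= bRZl /= xv zv expr2 mulrA.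
have sx : 2 / bR G x x * (bR G x v * bR G x v) = 2 * (s ^+ 2 * bR G x x).
  by rewrite xv; field; exact: ltr0_neq0.
rewrite {}sx {}vv; have [z0|z0] := eqVneq z 0; last first.
  have : 0 <= s ^+ 2 * - bR G x x by rewrite mulr_ge0 ?sqr_ge0 // oppr_ge0 ltW.
  by have := timelike_orth_gt0 xx xz z0; lra.
have s0 : s != 0.
  by apply: contra_neq v0 => s0; rewrite vE z0 s0 scale0r addr0.
have : 0 < s ^+ 2 * - bR G x x by rewrite mulr_gt0 ?oppr_gt0 // exprn_even_gt0.
by rewrite z0 linear0l; lra.
Qed.

Lemma causal_vector_bound x (C : RR) : bR G x x < 0 -> exists B : nat,
  forall u : 'rV[int]_n, bZ G u u <= 0 -> `|bR G x (rmx u)| <= C ->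
  forall i, `|u 0 i| <= B%:R.
Proof.
move=> xx; have [E bound] := posdef_coord_bound (majorant_posdef xx)
  (majorant_sym x) (2 / - bR G x x * C ^+ 2).
exists (Num.bound E) => u uu xu i.
have {bound} uE : `|rmx u 0 i| <= E.
  apply: bound; rewrite majorantE (bGC _ x) -expr2 bR_rmx.
  have {}uu : (bZ G u u)%:~R <= 0 :> RR by rewrite lerz0.
  have : 2 / - bR G x x * bR G x (rmx u) ^+ 2 <= 2 / - bR G x x * C ^+ 2.
    rewrite ler_wpM2l //; first by rewrite divr_ge0 // oppr_ge0 ltW.
    by rewrite -[leLHS]real_normK ?num_real // ler_pXn2r ?nnegrE // (le_trans _ xu).
  by rewrite invrN mulrN; lra.
have := le_lt_trans uE (archi_boundP (le_trans (normr_ge0 _) uE)).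
by rewrite mxE -intr_norm pmulrn ltr_int natz => /ltW.
Qed.

End Lorentzian.

(** * Cells *)

Lemma continuous_mulmxr (R : realType) m p (M : 'M[R]_(m, p)) :
  continuous (fun x : 'rV[R]_m => x *m M).
Proof.
have entry_cont j : continuous (fun x : 'rV[R]_m => (x *m M) 0 j).
  have -> : (fun x : 'rV[R]_m => (x *m M) 0 j) = fun x => \sum_i x 0 i * M i j.
    by apply/funext => x; rewrite mxE.
  apply: (@continuous_big R^o) => [|i _ x]; first exact: add_continuous.
  by apply: continuousM; [exact: coord_continuous | exact: cst_continuous].
move=> x A [P Pnbhs PA]; have Fx := nbhs_filter x.
have Pnear j : nbhs x (fun y => P 0 j ((y *m M) 0 j)) := entry_cont j x _ (Pnbhs 0 j).
apply: (@filterS _ _ Fx _ _ _ (@filter_forall _ _ _ _ Fx Pnear)) => y Py.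
by apply: PA => i j; rewrite ord1; exact: Py.
Qed.

Lemma continuous_bR n (G : 'M[int]_n) y : continuous (bR G ^~ y).
Proof.
have -> : bR G ^~ y = (fun M : 'M[RR]_1 => M 0 0) \o (fun x => x *m (rmx G *m y^T)).
  by apply/funext => x; rewrite /bR /= mulmxA.
move=> x; apply: continuous_comp; first exact: continuous_mulmxr.
exact: coord_continuous.
Qed.

Lemma connected_same_sign (R : realType) (T : topologicalType) (P : set T)
    (f : T -> R) x y :
  connected P -> continuous f -> (forall z, P z -> f z != 0) -> P x -> P y ->
  0 < f x * f y.
Proof.
move=> cP cf f0 Px Py.
have /connected_intervalP itvP : connected (f @` P).
  by apply: connected_continuous_connected cP _; exact: continuous_subspaceT.
have no_change a b : P a -> P b -> f a < 0 -> 0 < f b -> False.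
  move=> Pa Pb fa fb; have [c Pc fc0] : (f @` P) 0.
    by apply: (itvP (f a) (f b)); [exists a | exists b | rewrite !ltW].
  by have := f0 c Pc; rewrite fc0 eqxx.
case: (ltgtP (f x) 0) (f0 _ Px) => // fx _; case: (ltgtP (f y) 0) (f0 _ Py) => // fy _.
- by rewrite nmulr_rgt0.
- by case: (no_change x y).
- by case: (no_change y x).
- exact: mulr_gt0.
Qed.

(* The only consequences of directness that the chirality argument uses: the
   images of an interior point of the cell lie on the same side of all mirrors
   and in the same half of the cone. *)
Definition cell_preserving n (G g : 'M[int]_n) (x : 'rV[RR]_n) :=
  [/\ bR G x x < 0,
      forall r, root_vec G r -> 0 < bR G x (rmx r) * bR G (x *m rmx g) (rmx r)
    & bR G x (x *m rmx g) < 0].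

Lemma direct_cell_preserving n (G g : 'M[int]_n) : lorentzian G ->
  (exists P, lifted_cell G P /\ direct g P) -> exists x, cell_preserving G g x.
Proof.
move=> lorG [P [[x xA ->] dP]]; have [symG _] := lorG; exists x.
set A := cone_minus_mirrors G in xA dP *.
have Px : connected_component A x x by exact: connected_component_refl.
have Pxg : connected_component A x (x *m rmx g) by rewrite -dP; exists x.
have cP : connected (connected_component A x) by exact: component_connected.
have sub := @connected_component_sub _ A x.
have cone_neq0 y z : A y -> A z -> bR G y z != 0.
  move=> [yy _] [zz _]; apply: (timelike_causal_neq0 lorG yy (ltW zz)).
  by apply: contraTneq zz => ->; rewrite linear0l ltxx.
case: (xA) => xx xr; split=> // [r rr|].
  apply: (connected_same_sign cP (continuous_bR (y := rmx r))) => // z /sub[_]; exact.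
have := connected_same_sign cP (continuous_bR (G := G) (y := x)) _ Px Pxg.
by rewrite (bRC (x *m _)) // nmulr_rgt0 //; apply=> z /sub Az; exact: cone_neq0.
Qed.

Lemma dvdz_bZ_row n (G : 'M[int]_n) (d : int) u :
  (forall v, (d %| bZ G u v)%Z) -> exists w, u *m G = d *: w.
Proof.
move=> du; exists (\row_j divz ((u *m G) 0 j) d); apply/rowP => j.
have := du (delta_mx 0 j); rewrite /bZ trmx_delta -colE mxE => uGj.
by rewrite [RHS]mxE [X in _ * X]mxE mulrC divzK.
Qed.

(* Both twice and a power of 3 times the image are integral. *)
Lemma Z3_part_integral n (G S h : 'M[int]_n) (x : 'rV[rat]_n) :
  G *m S = 2 *: h -> in_dual G x -> (exists k : nat, integral (x *+ (3 ^ k))) ->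
  integral (x *m map_mx intr h).
Proof.
move=> GS [z xz] [k [y xy]].
have double : 2 *: (x *m map_mx intr h) = map_mx intr (z *m S).
  by rewrite map_mxM -xz -mulmxA -map_mxM GS map_mxZ scalemxAr.
have pow3 : (3 ^ k)%:R *: (x *m map_mx intr h) = map_mx intr (y *m h).
  by rewrite scalemxAl scaler_nat xy map_mxM.
have odd3 : (3 ^ k = 2 * (3 ^ k)./2 + 1)%N.
  by rewrite -{1}(odd_double_half (3 ^ k)) oddX orbT addnC mul2n.
exists (y *m h - (z *m S) *+ (3 ^ k)./2).
rewrite map_mxB raddfMn /= -double -pow3 {1}odd3 natrD scalerDl scale1r.
by rewrite mulnC natrM -scalerA scaler_nat addrAC subrr add0r.
Qed.

(* A third of [w] is a dual vector of order 3. *)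
Lemma Z3_reversing_dvdz3 n (G g : 'M[int]_n) (w : 'rV[int]_n) : Z3_reversing G g ->
  (forall v, (3 %| bZ G w v)%Z) -> exists z, w *m g + w = 3 *: z.
Proof.
move=> rg /dvdz_bZ_row[y yE]; pose x : 'rV[rat]_n := 3^-1 *: map_mx intr w.
have x3 : 3 *: x = map_mx intr w by rewrite scalerA divff // scale1r.
have [||z zE] := rg x.
- exists y; rewrite -scalemxAl -map_mxM yE map_mxZ scalerA.
  by rewrite mulVf // scale1r.
- by exists 1%N, w; rewrite expn1 -x3 scaler_nat.
exists z; apply: (@map_intr_mx_inj rat).
have := congr1 (fun v => (3 : rat) *: v) zE.
by rewrite scalerDr scalemxAl x3 map_mxD map_mxM map_mxZ.
Qed.

Section Conjugation.
Variables (n : nat) (G : 'M[int]_n).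
Hypothesis detG : \det G != 0.

Lemma cell_preserving_conj g h x : isometry G h -> cell_preserving G g x ->
  cell_preserving G (h *m g *m invmx h) (x *m rmx (invmx h)).
Proof.
move=> hG [xx xr xg]; have hV := isometryV detG hG.
have conjE : x *m rmx (invmx h) *m rmx (h *m g *m invmx h) =
    x *m rmx g *m rmx (invmx h).
  by rewrite !map_mxM !mulmxA rmx_mulmxKV // (isometry_unitmx detG hG).
split=> [|r rr|]; rewrite ?conjE; try by rewrite bR_isometry.
rewrite -[r](mulmxK (isometry_unitmx detG hG)).
by rewrite map_mxM !bR_isometry // xr //; exact: root_vec_isometry.
Qed.

Lemma Z3_reversing_conj g h : isometry G h -> Z3_reversing G g ->
  Z3_reversing G (h *m g *m invmx h).
Proof.
move=> hG rg x [z xz] [l [y xy]]; have hu := isometry_unitmx detG hG.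
pose q := (map_mx intr : 'M[int]_n -> 'M[rat]_n).
have hq : q h *m q (invmx h) = 1%:M by rewrite -map_mxM mulmxV // map_mx1.
have [||w wE] := rg (x *m q h).
- exists (z *m (invmx h)^T).
  rewrite map_mxM -xz -!mulmxA -!map_mxM; congr (_ *m map_mx _ _).
  by rewrite -{2}hG -!mulmxA -trmx_mul mulVmx // trmx1 mulmx1.
- by exists l, (y *m h); rewrite -scaler_nat scalemxAl scaler_nat xy map_mxM.
exists (w *m invmx h); rewrite !map_mxM -wE mulmxDl -!mulmxA.
by rewrite -/(q h) -/(q _) -/(q g) hq mulmx1.
Qed.

End Conjugation.

(** * Vectors closest to a point of a cell *)

Definition is_reflection n (G : 'M[int]_n) (r : 'rV[int]_n) (s : 'M[int]_n) :=
  forall x, x *m rmx s =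
    x - (2 * bR G x (rmx r) / bR G (rmx r) (rmx r)) *: rmx r.

Lemma root_reflection n (G : 'M[int]_n) r : G^T = G -> root_vec G r ->
  exists2 s : 'M[int]_n, isometry G s & is_reflection G r s.
Proof.
move=> symG rr.
have [w wE] : exists w : 'cV[int]_n, bZ G r r *: w = 2 *: (G *m r^T).
  case: rr => [->|[-> /dvdz_bZ_row[w wE]]]; first by exists (G *m r^T).
  exists w^T; rewrite -[G in RHS]symG -trmx_mul wE linearZ /= scalerA.
  by congr (_ *: _).
have r0 : bR G (rmx r) (rmx r) != 0.
  by rewrite bR_rmx intr_eq0 gt_eqF // root_vec_norm_gt0.
have reflE : is_reflection G r (1%:M - w *m r).
  move=> x; rewrite map_mxB map_mx1 map_mxM mulmxBr mulmx1 mulmxA.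
  rewrite [x *m rmx w]mx11_scalar mul_scalar_mx; congr (_ - _ *: _).
  apply: (mulIf r0); rewrite divfK // bR_rmx mulrC.
  have := congr1 (fun M => (x *m rmx M) 0 0) wE.
  by rewrite !map_mxZ map_mxM -map_trmx -!scalemxAr mulmxA mxE [RHS]mxE.
exists (1%:M - w *m r) => //; apply: isometry_of_bZ => u v.
apply: (@intr_inj RR); rewrite -!bR_rmx !map_mxM !reflE.
rewrite linearBl !linearBr /= !bRZl !bRZr /= (bRC (rmx r) (rmx v)) //.
by field.
Qed.

Lemma exists_min_vector n (O : set 'rV[int]_n) (phi : 'rV[int]_n -> RR) u0 (B : nat) :
  O u0 -> (forall u, O u -> phi u <= phi u0 -> forall i, `|u 0 i| <= B%:R) ->
  exists2 u, O u & forall v, O v -> phi u <= phi v.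
Proof.
move=> Ou0 bound; pose V := {ffun 'I_n -> 'I_(B + B).+1}.
pose decode (w : V) : 'rV[int]_n := \row_i ((w i : nat)%:Z - B%:Z).
have decode_onto u : O u -> phi u <= phi u0 -> exists w, u = decode w.
  move=> Ou /(bound u Ou) uB; exists [ffun i => inord (absz (u 0 i + B%:Z))].
  apply/rowP => i; rewrite mxE ffunE inordK; have := uB i; move: (u 0 i) => z;
    by rewrite natz; lia.
have [w0 w0E] := decode_onto u0 Ou0 (lexx _).
pose P w := `[< O (decode w) >].
have Pw0 : P w0 by apply/asboolP; rewrite -w0E.
have [w /asboolP Ow wmin] := Order.TotalTheory.arg_minP (phi \o decode) Pw0.
exists (decode w) => // v Ov.
have [/(decode_onto v Ov)[w' w'E]|/ltW] := leP (phi v) (phi u0).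
  by rewrite w'E; apply: wmin; apply/asboolP; rewrite -w'E.
by apply: le_trans; rewrite w0E; exact: wmin.
Qed.

Definition unseparated n (G : 'M[int]_n) (x : 'rV[RR]_n) (u r : 'rV[int]_n) :=
  0 <= bR G x (rmx r) * (bZ G u r)%:~R.

Lemma cell_preserving_unseparated_gt0 n (G g : 'M[int]_n) x u r :
  cell_preserving G g x -> root_vec G r -> unseparated G x u r ->
  0 < bZ G u r -> 0 < bR G x (rmx r).
Proof.
move=> [_ xr _] rr xur ur; move: xur.
rewrite /unseparated pmulr_lge0 ?ltr0z // le_eqVlt => /orP[/eqP x0|//].
by have := xr r rr; rewrite -x0 mul0r ltxx.
Qed.

Section ClosestVector.
Variables (n : nat) (G : 'M[int]_n).
Hypothesis lorG : lorentzian G.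
Implicit Types (x : 'rV[RR]_n) (u v r : 'rV[int]_n) (g h s : 'M[int]_n).

Let symG : G^T = G. Proof. by case: lorG. Qed.
Let detG : \det G != 0. Proof. exact: lorentzian_det_neq0. Qed.

Lemma isometry_causal_lt0 g x u : isometry G g -> bR G x x < 0 ->
  bR G x (x *m rmx g) < 0 -> bZ G u u <= 0 -> u != 0 -> bR G x (rmx u) < 0 ->
  bR G x (rmx (u *m g)) < 0.
Proof.
move=> gG xx xg uu u0 xu.
have ug0 : u *m g != 0.
  apply: contra_neq u0 => ug0.
  by rewrite -[u](mulmxK (isometry_unitmx detG gG)) ug0 mul0mx.
apply: (timelike_causal_lt0 lorG (x := x *m rmx g)).
- by rewrite bR_isometry.
- by [].
- by rewrite bR_rmx lerz0 bZ_isometry.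
- by rewrite rmx_eq0.
- by rewrite bRC.
- by rewrite map_mxM bR_isometry.
Qed.

Lemma reflection_timelike_lt0 r s x : root_vec G r ->
  is_reflection G r s -> bR G x x < 0 -> bR G x (x *m rmx s) < 0.
Proof.
move=> rr sE xx; rewrite sE linearBr /= bRZr /= subr_lt0.
apply: lt_le_trans xx _; rewrite mulrAC divr_ge0 //.
  by rewrite -mulrA mulr_ge0 // -expr2 sqr_ge0.
by rewrite bR_rmx ler0z ltW // root_vec_norm_gt0.
Qed.

Lemma exists_closest_vector x (O : set 'rV[int]_n) : bR G x x < 0 -> O !=set0 ->
  (forall u, O u -> bZ G u u <= 0 /\ bR G x (rmx u) < 0) ->
  exists2 u, O u & forall v, O v -> bR G x (rmx v) <= bR G x (rmx u).
Proof.
move=> xx [u0 Ou0] Oneg.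
have [B Bbound] := causal_vector_bound lorG (- bR G x (rmx u0)) xx.
have [|u Ou umin] := @exists_min_vector _ O (fun u => - bR G x (rmx u)) u0 B Ou0.
  move=> u Ou uu0; have [uu xu] := Oneg u Ou.
  by apply: Bbound => //; rewrite ltr0_norm.
by exists u => // v /umin; rewrite lerN2.
Qed.

(* Reflecting a vector in a mirror that separates it from [x] brings it closer
   to [x]. *)
Lemma closest_vector_mirror x u r s : root_vec G r -> is_reflection G r s ->
  bR G x (rmx (u *m s)) <= bR G x (rmx u) -> unseparated G x u r.
Proof.
move=> rr sE; rewrite map_mxM sE linearBr /= bRZr /= gerDl oppr_le0.
rewrite /unseparated !bR_rmx mulrAC pmulr_lge0 ?invr_gt0 ?ltr0z ?root_vec_norm_gt0 //.
by rewrite -mulrA pmulr_rge0 // mulrC.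
Qed.

Section NormalForm.
Variables e rho : 'rV[int]_n.
Hypotheses (ee : bZ G e e <= 0) (e0 : e != 0).
Hypotheses (rho2 : bZ G rho rho < 0) (rhoe : bZ G rho e < 0).

Lemma exists_closest_image x : bR G x x < 0 -> exists h, [/\ isometry G h,
  bR G x (rmx (e *m h)) < 0 &
  forall r, root_vec G r -> unseparated G x (e *m h) r].
Proof.
move=> xx; pose O := [set u | bR G x (rmx u) < 0 /\
  exists2 h, isometry G h & u = e *m h].
have [||u [xu [h hG uE]] umin] := exists_closest_vector (O := O) xx.
- have : bR G x (rmx e) != 0.
    by apply: (timelike_causal_neq0 lorG); rewrite ?bR_rmx ?lerz0 ?rmx_eq0.
  case: ltgtP => // xe _; [exists e | exists (- e)]; split=> //.
  + by exists 1%:M; [exact: isometry1 | rewrite mulmx1].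
  + by rewrite map_mxN linearNr /= oppr_lt0.
  + by exists (- 1%:M); [exact/isometryN/isometry1 | rewrite mulmxN mulmx1].
- by move=> u [xu [h hG uE]]; rewrite {1 2}uE bZ_isometry.
exists h; split; rewrite -?uE // => r rr.
have [s sG sE] := root_reflection symG rr.
apply: (closest_vector_mirror rr sE (umin _ _)); split.
  apply: isometry_causal_lt0 => //; first exact: reflection_timelike_lt0 rr sE xx.
    by rewrite uE bZ_isometry.
  by apply: contraTneq xu => ->; rewrite map_mx0 linear0r ltxx.
by exists (h *m s); [exact: isometryM | rewrite uE mulmxA].
Qed.

Lemma exists_closest_stab_image x h0 : bR G x x < 0 -> isometry G h0 ->
  bR G x (rmx (e *m h0)) < 0 -> exists h, [/\ isometry G h, e *m h = e *m h0 &
  forall r, root_vec G r -> bZ G (e *m h0) r = 0 ->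
    unseparated G x (rho *m h) r].
Proof.
move=> xx h0G xe; pose O := [set u | exists h,
  [/\ isometry G h, e *m h = e *m h0 & u = rho *m h]].
have [||u [h [hG he uE]] umin] := exists_closest_vector (O := O) xx.
- by exists (rho *m h0), h0.
- move=> _ [h [hG he ->]]; rewrite bZ_isometry //; split; first exact: ltW.
  apply: (timelike_lt0_of_causal lorG xx (u := rmx (e *m h0))) => //.
  + by rewrite bR_rmx ltrz0 bZ_isometry.
  + by rewrite bR_rmx lerz0 bZ_isometry.
  + by rewrite bR_rmx ltrz0 -he bZ_isometry.
exists h; split; rewrite -?uE // => r rr er.
have [s sG sE] := root_reflection symG rr.
apply: (closest_vector_mirror rr sE (umin _ _)).
exists (h *m s); split; [exact: isometryM | | by rewrite uE mulmxA].
apply: (@map_intr_mx_inj RR); rewrite mulmxA he map_mxM sE !bR_rmx er.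
by rewrite mulr0 mul0r scale0r subr0.
Qed.

Definition normalized g x := [/\ isometry G g, Z3_reversing G g,
  cell_preserving G g x, bR G x (rmx e) < 0 &
  forall r, root_vec G r -> unseparated G x e r /\
    (bZ G e r = 0 -> unseparated G x rho r)].

Lemma achiral_normalized : achiral G -> exists g x, normalized g x.
Proof.
move=> [g [gG rg /(direct_cell_preserving lorG)[x cg]]].
have xx : bR G x x < 0 by case: cg.
have [h0 [h0G xe0 er0]] := exists_closest_image xx.
have [h [hG he rhor]] := exists_closest_stab_image xx h0G xe0.
have pullback u : bR G (x *m rmx (invmx h)) (rmx u) = bR G x (rmx (u *m h)).
  by rewrite -(bR_isometry _ _ hG) rmx_mulmxKV ?(isometry_unitmx detG hG) // map_mxM.
exists (h *m g *m invmx h), (x *m rmx (invmx h)); split.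
- by apply: isometryM; [exact: isometryM | exact: isometryV].
- exact: Z3_reversing_conj.
- exact: cell_preserving_conj.
- by rewrite pullback he.
move=> r rr; have rhr := root_vec_isometry detG hG rr.
rewrite /unseparated pullback; split=> [|er].
  by rewrite -(bZ_isometry e r hG) he; exact: er0.
by rewrite -(bZ_isometry rho r hG); apply: rhor; rewrite // -he bZ_isometry.
Qed.

Section NormalizedPair.
Variables (g : 'M[int]_n) (x : 'rV[RR]_n).
Hypothesis gx : normalized g x.

Lemma normalized_root_gt0 r : root_vec G r -> 0 < bZ G e r -> 0 < bR G x (rmx r).
Proof.
case: gx => _ _ cg _ side rr; have [xer _] := side r rr.
exact: cell_preserving_unseparated_gt0 cg rr xer.
Qed.

Lemma normalized_wall_gt0 r : root_vec G r -> bZ G e r = 0 -> 0 < bZ G rho r ->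
  0 < bR G x (rmx r).
Proof.
case: gx => _ _ cg _ side rr er; have [_ /(_ er) xrhor] := side r rr.
exact: cell_preserving_unseparated_gt0 cg rr xrhor.
Qed.

Lemma normalized_image_gt0 r : root_vec G r -> 0 < bR G x (rmx r) ->
  0 < bR G (x *m rmx g) (rmx r).
Proof. by case: gx => _ _ [_ xr _] _ _ rr x0; have := xr r rr; rewrite pmulr_rgt0. Qed.

Lemma normalized_image_e_ge0 r : root_vec G r -> 0 < bR G x (rmx r) ->
  0 <= bZ G (e *m g) r.
Proof.
case: (gx) => gG _ _ _ side rr /(normalized_image_gt0 rr) x0.
have [+ _] := side _ (root_vec_isometry detG (isometryV detG gG) rr).
rewrite /unseparated -(bZ_isometry _ _ gG) (mulmxKV (isometry_unitmx detG gG)).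
rewrite -(bR_isometry _ _ gG) -map_mxM (mulmxKV (isometry_unitmx detG gG)).
by rewrite pmulr_rge0 ?ler0z.
Qed.

Lemma normalized_image_e_lt0 : bR G x (rmx (e *m g)) < 0.
Proof. by case: gx => gG _ [xx _ xg] xe _; exact: isometry_causal_lt0. Qed.

End NormalizedPair.
End NormalForm.
End ClosestVector.

(** * The lattice A2 *)

Definition A2_prod (R : pzRingType) (s t s' t' : R) :=
  2 * s * s' - s * t' - t * s' + 2 * t * t'.

Definition A2_norm (R : pzRingType) (s t : R) := s * s - s * t + t * t.

Lemma A2_prodxx (R : comPzRingType) (s t : R) : A2_prod s t s t = 2 * A2_norm s t.
Proof. by rewrite /A2_prod /A2_norm; ring. Qed.

Lemma A2_norm_ge0 (R : realDomainType) (s t : R) : 0 <= A2_norm s t.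
Proof. by rewrite /A2_norm; nra. Qed.

Lemma A2_norm_eq0 (R : realDomainType) (s t : R) :
  A2_norm s t = 0 -> s = 0 /\ t = 0.
Proof.
have snd_eq0 (x y : R) : A2_norm x y = 0 -> y = 0.
  rewrite /A2_norm => xy; apply/eqP; rewrite -sqrf_eq0 eq_le sqr_ge0 andbT.
  by have := sqr_ge0 (2 * x - y); rewrite !expr2; lra.
move=> st; split; last exact: snd_eq0 st.
by apply: (snd_eq0 t); rewrite -st /A2_norm; ring.
Qed.

Lemma A2_norm_odd (s t : int) : ~~ ((2 %| s)%Z && (2 %| t)%Z) ->
  exists c : int, A2_norm s t = 2 * c + 1.
Proof.
have half (c : int) : exists p i : int, c = 2 * p + i /\ (i = 0 \/ i = 1).
  by exists (c %/ 2)%Z, (c %% 2)%Z; lia.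
have [p [i [-> [->|->]]]] := half s; have [q [j [-> [->|->]]]] := half t.
- by move=> /negP[]; apply/andP; split; lia.
- by move=> _; exists (2 * p * p - 2 * p * q - p + 2 * q * q + 2 * q);
    rewrite /A2_norm; ring.
- by move=> _; exists (2 * p * p + 2 * p - 2 * p * q - q + 2 * q * q);
    rewrite /A2_norm; ring.
- by move=> _; exists (2 * p * p + p - 2 * p * q + 2 * q * q + q);
    rewrite /A2_norm; ring.
Qed.

(* The vectors of norm 6 of A2 fall in two classes modulo 3 A2. *)
Lemma A2_norm3_mod3 (s t : int) : A2_norm s t = 3 ->
  (3 %| s + 1)%Z -> (3 %| t - 1)%Z ->
  [\/ s = -1 /\ t = 1, s = -1 /\ t = -2 | s = 2 /\ t = 1].
Proof.
rewrite /A2_norm => st.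
have [sB tB] : -2 <= s <= 2 /\ -2 <= t <= 2.
  have s4 : s * s <= 4 by have := sqr_ge0 (2 * t - s); rewrite expr2; lia.
  have t4 : t * t <= 4 by have := sqr_ge0 (2 * s - t); rewrite expr2; lia.
  by clear st; split; nia.
move=> /dvdzP[p pE] /dvdzP[q qE].
have sE : s = 3 * p - 1 by lia.
have tE : t = 3 * q + 1 by lia.
have [p0|p1] : p = 0 \/ p = 1 by lia.
  have [q0|q1] : q = 0 \/ q = -1 by lia.
    by apply: Or31; lia.
  by apply: Or32; lia.
have [q0|q1] : q = 0 \/ q = -1 by lia.
  by apply: Or33; lia.
by exfalso; move: st; rewrite sE tE p1 q1; lia.
Qed.

(* The unit cell is cut into two equilateral triangles; a point with largest
   barycentric coordinate at a vertex is within 2/3 of an edge length of it. *)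
Lemma A2_covering (R : realType) (y1 y2 : R) : exists m1 m2 : int,
  A2_norm (y1 - m1%:~R) (y2 - m2%:~R) < 1 / 2.
Proof.
have /andP[] := floor_itv y1; have /andP[] := floor_itv y2.
move: (Num.floor y1) (Num.floor y2) => n1 n2; rewrite !intrD.
set u := y1 - n1%:~R; set v := y2 - n2%:~R => v0 v1 u0 u1.
have vertex (i j : int) : A2_norm (u - i%:~R) (v - j%:~R) < 1 / 2 ->
    exists m1 m2 : int, A2_norm (y1 - m1%:~R) (y2 - m2%:~R) < 1 / 2.
  by move=> uv; exists (n1 + i), (n2 + j); rewrite !intrD !opprD !addrA.
have [{}u0 {}u1] : 0 <= u /\ u < 1 by rewrite /u; lra.
have [{}v0 {}v1] : 0 <= v /\ v < 1 by rewrite /v; lra.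
have [vu|uv] := leP v u.
  have [near00|far00] := leP (1 / 3) (1 - u).
    by apply: (vertex 0 0); rewrite /A2_norm; nra.
  have [near10|far10] := leP (1 / 3) (u - v).
    by apply: (vertex 1 0); rewrite /A2_norm; nra.
  by apply: (vertex 1 1); rewrite /A2_norm; nra.
have [near00|far00] := leP (1 / 3) (1 - v).
  by apply: (vertex 0 0); rewrite /A2_norm; nra.
have [near01|far01] := leP (1 / 3) (v - u).
  by apply: (vertex 0 1); rewrite /A2_norm; nra.
by apply: (vertex 1 1); rewrite /A2_norm; nra.
Qed.

Lemma A2_covering_odd (R : realType) (y1 y2 : R) :
  (exists m1 m2 : int, ~~ ((2 %| m1)%Z && (2 %| m2)%Z) /\
    A2_norm (y1 - m1%:~R) (y2 - m2%:~R) < 1) \/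
  (exists s t : int, y1 = 2 * s%:~R /\ y2 = 2 * t%:~R).
Proof.
have /andP[] := floor_itv y1; have /andP[] := floor_itv y2.
move: (Num.floor y1) (Num.floor y2) => n1 n2; rewrite !intrD.
set u := y1 - n1%:~R; set v := y2 - n2%:~R => v0 v1 u0 u1.
have [{}u0 {}u1] : 0 <= u /\ u < 1 by rewrite /u; lra.
have [{}v0 {}v1] : 0 <= v /\ v < 1 by rewrite /v; lra.
have [/andP[/dvdzP[s n1E] /dvdzP[t n2E]]|odd_n] :=
  boolP ((2 %| n1)%Z && (2 %| n2)%Z); last first.
  left; exists n1, n2; split=> //; rewrite -/u -/v /A2_norm.
  by have [vu|uv] := leP v u; nra.
have [uv0|uv0] := leP (u + v) 0.
  have /subr0_eq-> : u = 0 by lra.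
  have /subr0_eq-> : v = 0 by lra.
  by right; exists s, t; rewrite n1E n2E !intrM; split; ring.
left; have [vu|uv] := leP v u.
  exists (n1 + 1), n2; split; first by apply/negP => /andP[+ _]; lia.
  by rewrite intrD opprD addrA -/u -/v /A2_norm; nra.
exists n1, (n2 + 1); split; first by apply/negP => /andP[_ +]; lia.
by rewrite intrD opprD addrA -/u -/v /A2_norm; nra.
Qed.

Lemma intr_lt_eq0 (R : realDomainType) (j : int) (E : R) :
  0 < E -> - E < j%:~R * E < E -> j = 0.
Proof.
move=> E0 /andP[jl ju].
have j_gt : -1 < j by rewrite -(ltr_int R) -(ltr_pM2r E0) mulrN1z mulN1r.
have j_lt : j < 1 by rewrite -(ltr_int R) -(ltr_pM2r E0) mul1r.
by lia.
Qed.

Lemma A2_norm_sub (m11 m12 m21 m22 : int) :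
  A2_norm (m11 - m21) (m12 - m22) =
  A2_norm m11 m12 + A2_norm m21 m22 - A2_prod m11 m12 m21 m22.
Proof. by rewrite /A2_norm /A2_prod; ring. Qed.

Lemma A2_frame_sum (m11 m12 m21 m22 : int) :
  A2_norm m11 m12 = 1 -> A2_norm m21 m22 = 1 -> m11 - m21 = 2 -> m12 - m22 = 1 ->
  m11 + m21 = 0 /\ (m12 + m22 = 1 \/ m12 + m22 = -1).
Proof.
move=> n1 n2 d1 d2; have s0 : m11 + m21 = 0 by move: n1 n2; rewrite /A2_norm; lia.
by split=> //; move: n1 n2; rewrite /A2_norm; nia.
Qed.

(* The triangle 0 < y2 < y1, y1 + y2 < E has angles 30, 60 and 90 degrees, so an
   isometry of the plane preserving it is the identity.  In terms of
   d = m1 - m2 and s = m1 + m2, orthogonal of norms 6 and 2: if the discriminant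
   is reversed then the position of the image forces d = (2, 1), hence
   s = (0, 1) or (0, -1), and then the image lies on the wrong side. *)
Lemma A2_alcove_rigid (R : realFieldType) (c1 c2 m11 m12 m21 m22 : int)
    (y1 y2 E : R) :
  A2_norm m11 m12 = 1 -> A2_norm m21 m22 = 1 -> A2_prod m11 m12 m21 m22 = -1 ->
  (3 %| c1 - c2)%Z -> (3 %| m11 - m21 + 1)%Z -> (3 %| m12 - m22 - 1)%Z ->
  0 < y2 -> y2 < y1 -> y1 + y2 < E ->
  let z1 := m11%:~R * y1 + m12%:~R * y2 - c1%:~R * E in
  let z2 := m21%:~R * y1 + m22%:~R * y2 - c2%:~R * E in
  0 < z2 -> z2 < z1 -> z1 + z2 < E -> False.
Proof.
move=> n1 n2 n12 /dvdzP[j cj] d1 d2 y20 y12 yE.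
set e1 := m11 - m21 in d1 *; set e2 := m12 - m22 in d2 *.
have {cj} cE : c1 = c2 + j * 3 by lia.
have d3 : A2_norm e1 e2 = 3 by rewrite A2_norm_sub n1 n2 n12.
move=> z1 z2; have dE : z1 - z2 = e1%:~R * y1 + e2%:~R * y2 - j%:~R * (3 * E).
  by rewrite /z1 /z2 /e1 /e2 cE; ring.
have sE : z1 + z2 = (m11 + m21)%:~R * y1 + (m12 + m22)%:~R * y2 - (c1 + c2)%:~R * E.
  by rewrite /z1 /z2; ring.
move: z1 z2 dE sE => z1 z2 dE sE z20 z12 zE.
have d_lt : - (2 * E) < e1%:~R * y1 + e2%:~R * y2 < 2 * E.
  by have [[-> ->]|[-> ->]|[-> ->]] := A2_norm3_mod3 d3 d1 d2; apply/andP; split; lra.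
have j0 : j = 0.
  by apply: (@intr_lt_eq0 R j (3 * E)); [lra | apply/andP; split; lra].
have [e1E e2E] : e1 = 2 /\ e2 = 1.
  have [[e1E e2E]|[e1E e2E]|//] := A2_norm3_mod3 d3 d1 d2;
    by exfalso; move: dE; rewrite e1E e2E j0; lra.
have [sum1 sum2] := A2_frame_sum n1 n2 e1E e2E.
have c10 : c1 = 0.
  apply: (@intr_lt_eq0 R c1 (2 * E)); first by lra.
  move: sE; rewrite sum1 cE j0 mul0r addr0.
  by case: sum2 => -> sE; apply/andP; split; lra.
move: dE sE; rewrite sum1 e1E e2E j0 (_ : c2 = 0); last by lia.
by rewrite c10; case: sum2 => ->; lra.
Qed.

(** * The lattices U(k) + A2 + N *)

Definition row2 (R : Type) (a b : R) : 'rV[R]_2 :=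
  \row_j (if j == 0 then a else b).

Lemma row2_surj (R : Type) (x : 'rV[R]_2) : x = row2 (x 0 0) (x 0 1).
Proof.
apply/rowP => j; rewrite mxE; case: ifP => [/eqP->//|j0]; congr (x _ _).
by apply/val_inj; case: j j0 => [[|[|]]].
Qed.

Lemma row2_inj (R : Type) (a b a' b' : R) :
  row2 a b = row2 a' b' -> a = a' /\ b = b'.
Proof. by move=> /rowP e; move: (e 0) (e 1); rewrite !mxE. Qed.

Lemma gram_form_row2 (R : comNzRingType) (M : 'M[R]_2) a b a' b' :
  gram_form M (row2 a b) (row2 a' b') =
  a * M 0 0 * a' + a * M 0 1 * b' + b * M 1 0 * a' + b * M 1 1 * b'.
Proof.
have ord01 : lift 0 0 = 1 :> 'I_2 by apply/val_inj.
rewrite /gram_form !mxE big_ord_recl big_ord1 !mxE !big_ord_recl !big_ord0 !mxE /=.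
by rewrite ord01; ring.
Qed.

Definition UA2_lattice k n (N : 'M[int]_n) : 'M[int]_(2 + 2 + n) :=
  osum (osum (U *+ k) A2) N.

Definition UA2_vec (R : Type) n (a b s t : R) (v : 'rV[R]_n) : 'rV[R]_(2 + 2 + n) :=
  row_mx (row_mx (row2 a b) (row2 s t)) v.

Lemma UA2_vec_surj (R : Type) n (x : 'rV[R]_(2 + 2 + n)) :
  exists a b s t v, x = UA2_vec a b s t v.
Proof.
exists (lsubmx (lsubmx x) 0 0), (lsubmx (lsubmx x) 0 1).
exists (rsubmx (lsubmx x) 0 0), (rsubmx (lsubmx x) 0 1), (rsubmx x).
by rewrite /UA2_vec -!row2_surj !hsubmxK.
Qed.

Lemma UA2_vec_inj (R : Type) n (a b s t a' b' s' t' : R) (v v' : 'rV[R]_n) :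
  UA2_vec a b s t v = UA2_vec a' b' s' t' v' ->
  [/\ a = a', b = b', s = s', t = t' & v = v'].
Proof.
move=> vecE; have [uvE ->] := eq_row_mx vecE; have [uE vE] := eq_row_mx uvE.
by have [-> ->] := row2_inj uE; have [-> ->] := row2_inj vE.
Qed.

Lemma map_UA2_vec (R S : Type) (f : R -> S) n (a b s t : R) (v : 'rV[R]_n) :
  map_mx f (UA2_vec a b s t v) = UA2_vec (f a) (f b) (f s) (f t) (map_mx f v).
Proof.
rewrite /UA2_vec !map_row_mx; congr (row_mx (row_mx _ _) _);
  by apply/rowP => j; rewrite !mxE; case: ifP.
Qed.

Section UA2VecLinear.
Variables (R : pzRingType) (n : nat).
Implicit Types (a b c s t : R) (v : 'rV[R]_n).

Lemma UA2_vecD a b s t v a' b' s' t' v' :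
  UA2_vec a b s t v + UA2_vec a' b' s' t' v' =
  UA2_vec (a + a') (b + b') (s + s') (t + t') (v + v').
Proof.
rewrite /UA2_vec !add_row_mx; congr (row_mx (row_mx _ _) _);
  by apply/rowP => j; rewrite !mxE; case: ifP.
Qed.

Lemma UA2_vecZ c a b s t v :
  c *: UA2_vec a b s t v = UA2_vec (c * a) (c * b) (c * s) (c * t) (c *: v).
Proof.
rewrite /UA2_vec !scale_row_mx; congr (row_mx (row_mx _ _) _);
  by apply/rowP => j; rewrite !mxE; case: ifP.
Qed.

Lemma UA2_vecB a b s t v a' b' s' t' v' :
  UA2_vec a b s t v - UA2_vec a' b' s' t' v' =
  UA2_vec (a - a') (b - b') (s - s') (t - t') (v - v').
Proof. by rewrite -scaleN1r UA2_vecZ UA2_vecD !mulN1r scaleN1r. Qed.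

Lemma UA2_vec0 : UA2_vec 0 0 0 0 0 = 0 :> 'rV[R]_(2 + 2 + n).
Proof. by rewrite -[RHS](subrr (UA2_vec 0 0 0 0 0)) UA2_vecB !subr0. Qed.

End UA2VecLinear.

Section UA2Lattice.
Variables (k n : nat) (N : 'M[int]_n).
Local Notation G := (UA2_lattice k N).

Lemma bZ_UA2 a b s t v a' b' s' t' v' :
  bZ G (UA2_vec a b s t v) (UA2_vec a' b' s' t' v') =
  k%:R * (a * b' + b * a') + A2_prod s t s' t' + bZ N v v'.
Proof.
rewrite !bZ_osum [bZ (U *+ k) _ _]gram_form_row2 [bZ A2 _ _]gram_form_row2.
by rewrite !mulmxnE !mxE /edges /= !mul0rn /A2_prod; ring.
Qed.

Lemma bR_UA2 a b s t v a' b' s' t' v' :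
  bR G (UA2_vec a b s t v) (UA2_vec a' b' s' t' v') =
  k%:R * (a * b' + b * a') + A2_prod s t s' t' + bR N v v'.
Proof.
rewrite !bR_osum [bR (U *+ k) _ _]gram_form_row2 [bR A2 _ _]gram_form_row2.
by rewrite !mxE !mulmxnE !mxE /edges /= !mul0rn -pmulrn /A2_prod; ring.
Qed.

Lemma UA2_sym : N^T = N -> G^T = G.
Proof.
move=> symN; rewrite !osum_sym ?cartan_sym //.
by apply/matrixP => i j; rewrite mulmxnE !mxE mulmxnE !mxE eq_sym.
Qed.

Lemma UA2_lorentzian : (0 < k)%N -> N^T = N -> posdef (rmx N) -> lorentzian G.
Proof.
move=> k0 symN posN; have kR : 0 < k%:R :> RR by rewrite ltr0n.
split; first exact: UA2_sym.
exists (UA2_vec 1 (-1) 0 0 0) => [|z].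
  by rewrite bR_UA2 linear0l /A2_prod; lra.
have [a [b [s [t [v ->]]]]] := UA2_vec_surj z.
rewrite !bR_UA2 linear0l A2_prodxx => tz z0.
have {tz} ab : b = a.
  have : k%:R * (b - a) = 0 by move: tz; rewrite /A2_prod; lra.
  by move=> /eqP; rewrite mulf_eq0 gt_eqF //= subr_eq0 => /eqP.
have st0 := A2_norm_ge0 s t; have v0 : 0 <= bR N v v := posdef_ge0 posN v.
have a0 : 0 <= k%:R * (a * a) by apply: mulr_ge0; [exact: ltW | rewrite -expr2 sqr_ge0].
rewrite ab lt_neqAle; apply/andP; split; last by lra.
apply: contraNneq z0 => zz.
have /A2_norm_eq0[-> ->] : A2_norm s t = 0 by lra.
have -> : v = 0 by apply: (posdef_eq0 posN); rewrite -[LHS]/(bR N v v); lra.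
have : k%:R * (a * a) = 0 by lra.
move=> /eqP; rewrite mulf_eq0 gt_eqF //= mulf_eq0 orbb => /eqP a00.
by rewrite ab a00 UA2_vec0.
Qed.

End UA2Lattice.

(** * Isometries fixing the isotropic vector of U(k) *)

Lemma posdef_bZ_ge0 n (N : 'M[int]_n) v : posdef (rmx N) -> 0 <= bZ N v v.
Proof. by move=> posN; rewrite -(ler_int RR) -bR_rmx; exact: posdef_ge0. Qed.

Lemma posdef_bZ_eq0 n (N : 'M[int]_n) v : posdef (rmx N) -> bZ N v v = 0 -> v = 0.
Proof.
move=> posN vv; apply/eqP; rewrite -rmx_eq0; apply/eqP/(posdef_eq0 posN).
by rewrite -[LHS]/(bR N _ _) bR_rmx vv.
Qed.

Section Alcove.
Variables (k n : nat) (N : 'M[int]_n).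
Hypotheses (symN : N^T = N) (posN : posdef (rmx N)).
Local Notation G := (UA2_lattice k N).

Definition e_vec : 'rV[int]_(2 + 2 + n) := UA2_vec 1 0 0 0 0.
Definition a1_vec : 'rV[int]_(2 + 2 + n) := UA2_vec 0 0 1 0 0.
Definition a2_vec : 'rV[int]_(2 + 2 + n) := UA2_vec 0 0 0 1 0.

(* The walls a2, a1 - a2 and - e - a1 - a2 of an alcove of the affine Weyl group
   of type G2 *)
Definition alcove_walls : seq 'rV[int]_(2 + 2 + n) :=
  [:: a2_vec; UA2_vec 0 0 1 (-1) 0; UA2_vec (-1) 0 (-1) (-1) 0].

Definition alcove (x : 'rV[RR]_(2 + 2 + n)) :=
  {in alcove_walls, forall r, 0 < bR G x (rmx r)}.

Lemma alcove_walls_root : {in alcove_walls, forall r, root_vec G r}.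
Proof.
move=> r; rewrite !inE => /or3P[]/eqP->; [left | right | left];
  rewrite bZ_UA2 linear0l /A2_prod; [lia | split; first lia | lia].
move=> w; have [a [b [s [t [v ->]]]]] := UA2_vec_surj w.
by rewrite bZ_UA2 linear0l /A2_prod; apply/dvdzP; exists (s - t); lia.
Qed.

Lemma bR_e_orth x c m1 m2 : bR G x (rmx (UA2_vec c 0 m1 m2 0)) =
  c%:~R * bR G x (rmx e_vec) + m1%:~R * bR G x (rmx a1_vec) +
  m2%:~R * bR G x (rmx a2_vec).
Proof.
rewrite -!bRZr -!linearDr /= -!map_mxZ -!map_mxD !UA2_vecZ !UA2_vecD.
by rewrite !scaler0 !mulr0 !mulr1 !addr0 !add0r.
Qed.

Lemma alcoveP x : alcove x <-> [/\ 0 < bR G x (rmx a2_vec),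
  bR G x (rmx a2_vec) < bR G x (rmx a1_vec) &
  bR G x (rmx a1_vec) + bR G x (rmx a2_vec) < - bR G x (rmx e_vec)].
Proof.
split=> [xA|[x2 x12 x3] r].
  have wall i : (i < 3)%N -> 0 < bR G x (rmx (nth 0 alcove_walls i)).
    by move=> i3; exact/xA/mem_nth.
  have := wall 0%N isT; have := wall 1%N isT; have := wall 2%N isT.
  rewrite /= (bR_e_orth x (-1)) (bR_e_orth x 0 1 (-1)) => x3 x12 x2.
  by split; lra.
by rewrite !inE => /or3P[]/eqP-> //; rewrite bR_e_orth; lra.
Qed.

Lemma e_orth_image g u : isometry G g -> e_vec *m g = e_vec -> (0 < k)%N ->
  bZ G u e_vec = 0 -> exists c m1 m2 v, u *m g = UA2_vec c 0 m1 m2 v.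
Proof.
move=> gG ge k0 ue; have [c [d [m1 [m2 [v ugE]]]]] := UA2_vec_surj (u *m g).
exists c, m1, m2, v; rewrite ugE; congr UA2_vec.
have : bZ G (u *m g) e_vec = 0 by rewrite -ge bZ_isometry.
rewrite ugE bZ_UA2 linear0r /A2_prod => de; apply/eqP.
have : k%:R * d = 0 by lia.
by move=> /eqP; rewrite mulf_eq0 pnatr_eq0 -[k == 0]/(k == 0)%N eqn0Ngt k0.
Qed.

Lemma a1_sub_a2_reversing g : Z3_reversing G g ->
  exists z, (a1_vec - a2_vec) *m g + (a1_vec - a2_vec) = 3 *: z.
Proof.
move=> rg; apply: Z3_reversing_dvdz3 rg _ => w.
have [a [b [s [t [v ->]]]]] := UA2_vec_surj w.
rewrite UA2_vecB bZ_UA2 !subr0 linear0l /A2_prod.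
by apply/dvdzP; exists (s - t); lia.
Qed.

(* The norm of [v1 - v2] is at most 6, and divisible by 9. *)
Lemma A2_frame_orth_eq0 (m11 m12 m21 m22 : int) (v1 v2 w : 'rV[int]_n) :
  v1 - v2 = 3 *: w -> 2 * A2_norm m11 m12 + bZ N v1 v1 = 2 ->
  2 * A2_norm m21 m22 + bZ N v2 v2 = 2 -> A2_prod m11 m12 m21 m22 + bZ N v1 v2 = -1 ->
  v1 = 0 /\ v2 = 0.
Proof.
move=> v12 n1 n2 n12.
have w_norm : bZ N v1 v1 - bZ N v1 v2 - (bZ N v1 v2 - bZ N v2 v2) = 9 * bZ N w w.
  transitivity (bZ N (v1 - v2) (v1 - v2)).
    by rewrite linearBl !linearBr /= (bZC v2 v1).
  by rewrite v12 linearZl_LR linearZr_LR /= mulrA.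
have w0 : w = 0.
  apply: (posdef_bZ_eq0 posN).
  have := posdef_bZ_ge0 w posN; have := A2_norm_ge0 (m11 - m21) (m12 - m22).
  by move: n1 n2 n12 w_norm; rewrite /A2_norm /A2_prod; lia.
move: v12; rewrite w0 scaler0 => /subr0_eq v12; rewrite {}v12 in n1 n12 *.
suff /(posdef_bZ_eq0 posN)-> : bZ N v2 v2 = 0 by [].
have v2_ge0 := posdef_bZ_ge0 v2 posN; have m1_ge0 := A2_norm_ge0 m11 m12.
have [m1_0|m1_1] : A2_norm m11 m12 = 0 \/ A2_norm m11 m12 = 1.
  by move: n1 m1_ge0; rewrite /A2_norm; lia.
  by have [m11_0 m12_0] := A2_norm_eq0 m1_0; move: n1 n12;
    rewrite m11_0 m12_0 /A2_norm /A2_prod; lia.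
by move: n1; rewrite m1_1; lia.
Qed.

Lemma A2_image_reversing g : (0 < k)%N -> isometry G g -> Z3_reversing G g ->
  e_vec *m g = e_vec -> exists c1 c2 m11 m12 m21 m22,
  [/\ a1_vec *m g = UA2_vec c1 0 m11 m12 0, a2_vec *m g = UA2_vec c2 0 m21 m22 0,
    [/\ A2_norm m11 m12 = 1, A2_norm m21 m22 = 1 & A2_prod m11 m12 m21 m22 = -1] &
    [/\ (3 %| c1 - c2)%Z, (3 %| m11 - m21 + 1)%Z & (3 %| m12 - m22 - 1)%Z]].
Proof.
move=> k0 gG rg ge.
have [c1 [m11 [m12 [v1 a1g]]]] : exists c m1 m2 v, a1_vec *m g = UA2_vec c 0 m1 m2 v.
  by apply: e_orth_image => //; rewrite bZ_UA2 linear0r /A2_prod; lia.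
have [c2 [m21 [m22 [v2 a2g]]]] : exists c m1 m2 v, a2_vec *m g = UA2_vec c 0 m1 m2 v.
  by apply: e_orth_image => //; rewrite bZ_UA2 linear0r /A2_prod; lia.
have [z] := a1_sub_a2_reversing rg.
have [z1 [z2 [z3 [z4 [z5 ->]]]]] := UA2_vec_surj z.
rewrite mulmxBl a1g a2g !UA2_vecB UA2_vecD UA2_vecZ => vecE.
have [e1 _ e3 e4] := UA2_vec_inj vecE; rewrite subrr addr0 => e5.
have := bZ_isometry a1_vec a1_vec gG; have := bZ_isometry a2_vec a2_vec gG.
have := bZ_isometry a1_vec a2_vec gG.
rewrite a1g a2g !bZ_UA2 !linear0l !mulr0 !mul0r !addr0 !mulr0 !add0r !A2_prodxx.
move=> n12 n2 n1; have [v10 v20] := A2_frame_orth_eq0 e5 n1 n2 n12.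
move: n1 n2 n12; rewrite {}v10 {}v20 !linear0l !addr0 in a1g a2g * => n1 n2 n12.
exists c1, c2, m11, m12, m21, m22; split=> //.
  by move: n1 n2 n12; rewrite /A2_norm /A2_prod; split; lia.
by split; apply/dvdzP; [exists z1 | exists z3 | exists z4]; lia.
Qed.

Lemma alcove_not_reversing g x : (0 < k)%N -> isometry G g -> Z3_reversing G g ->
  e_vec *m g = e_vec -> alcove x -> ~ alcove (x *m rmx g).
Proof.
move=> k0 gG rg ge.
have [c1 [c2 [m11 [m12 [m21 [m22 [a1g a2g [n1 n2 n12] [c12 m1 m2]]]]]]]] :=
  A2_image_reversing k0 gG rg ge.
set y := x *m rmx g.
have ye : bR G x (rmx e_vec) = bR G y (rmx e_vec).
  by rewrite -[in RHS]ge map_mxM bR_isometry.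
have y1 : bR G x (rmx a1_vec) = bR G y (rmx (UA2_vec c1 0 m11 m12 0)).
  by rewrite -a1g map_mxM bR_isometry.
have y2 : bR G x (rmx a2_vec) = bR G y (rmx (UA2_vec c2 0 m21 m22 0)).
  by rewrite -a2g map_mxM bR_isometry.
move=> /alcoveP; rewrite y1 y2 ye [in X in [/\ X, _ & _]]bR_e_orth.
rewrite !(bR_e_orth y c1) !(bR_e_orth y c2) => -[x2 x12 x3] /alcoveP[z2 z12 z3].
apply: (A2_alcove_rigid n1 n2 n12 c12 m1 m2 z2 z12 z3); lra.
Qed.
End Alcove.

(** * Chirality *)

Section Chirality.
Variables (k n : nat) (N : 'M[int]_n).
Hypotheses (k0 : (0 < k)%N) (symN : N^T = N) (posN : posdef (rmx N)).
Local Notation G := (UA2_lattice k N).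
Local Notation e_vec := (e_vec n).

(* A timelike vector whose projection lies in the alcove *)
Definition rho_vec : 'rV[int]_(2 + 2 + n) := UA2_vec 2 (- 8) 4 3 0.

Let lorG : lorentzian G. Proof. exact: UA2_lorentzian. Qed.
Let detG : \det G != 0. Proof. exact: lorentzian_det_neq0. Qed.

Lemma e_vec_isotropic : bZ G e_vec e_vec = 0.
Proof. by rewrite bZ_UA2 linear0l /A2_prod; lia. Qed.

Lemma e_vec_neq0 : e_vec != 0.
Proof. by apply/eqP; rewrite -UA2_vec0 => vecE; have [] := UA2_vec_inj vecE. Qed.

Lemma rho_vec_timelike : bZ G rho_vec rho_vec < 0.
Proof. by rewrite bZ_UA2 linear0l /A2_prod; lia. Qed.

Lemma rho_vec_e_lt0 : bZ G rho_vec e_vec < 0.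
Proof. by rewrite bZ_UA2 linear0l /A2_prod; lia. Qed.

Lemma achiral_normalized_UA2 :
  achiral G -> exists g x, normalized G e_vec rho_vec g x.
Proof.
have ee : bZ G e_vec e_vec <= 0 by rewrite e_vec_isotropic.
exact: (achiral_normalized lorG ee e_vec_neq0 rho_vec_timelike rho_vec_e_lt0).
Qed.

Section NormalizedUA2.
Variables (g : 'M[int]_(2 + 2 + n)) (x : 'rV[RR]_(2 + 2 + n)).
Hypothesis gx : normalized G e_vec rho_vec g x.

Lemma normalized_alcove : alcove k N x.
Proof.
move=> r rW; apply: (normalized_wall_gt0 gx (alcove_walls_root k N rW));
  move: rW; rewrite !inE => /or3P[]/eqP->;
  by rewrite bZ_UA2 linear0l /A2_prod; lia.
Qed.

Lemma normalized_alcove_image : alcove k N (x *m rmx g).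
Proof.
move=> r rW; apply: (normalized_image_gt0 gx (alcove_walls_root k N rW)).
exact: normalized_alcove.
Qed.

Lemma normalized_moves_e : e_vec *m g != e_vec.
Proof.
case: (gx) => gG rg _ _ _; apply/eqP => ge.
exact: (alcove_not_reversing symN posN k0 gG rg ge) normalized_alcove
  normalized_alcove_image.
Qed.

Lemma image_e_primitive c u : e_vec *m g = c *: u -> (c %| 1)%Z.
Proof.
case: (gx) => gG _ _ _ _ egE.
have : e_vec = c *: (u *m invmx g).
  by rewrite scalemxAl -egE mulmxK // (isometry_unitmx detG gG).
have [a [b [s [t [v ->]]]]] := UA2_vec_surj (u *m invmx g).
rewrite UA2_vecZ => vecE; have [c1 _ _ _ _] := UA2_vec_inj vecE.
by apply/dvdzP; exists a; rewrite mulrC -c1.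
Qed.

Lemma image_e_norm a b s t v : e_vec *m g = UA2_vec a b s t v ->
  k%:R * (a * b + b * a) + 2 * A2_norm s t + bZ N v v = 0.
Proof.
case: (gx) => gG _ _ _ _ egE.
by rewrite -A2_prodxx -bZ_UA2 -egE bZ_isometry // e_vec_isotropic.
Qed.

Lemma image_e_f_lt0 a b s t v : e_vec *m g = UA2_vec a b s t v -> b < 0.
Proof.
case: (gx) => gG _ [xx _ _] xe _ egE.
have ee : bZ G e_vec e_vec <= 0 by rewrite e_vec_isotropic.
have xeg := normalized_image_e_lt0 lorG ee e_vec_neq0 gx.
have : bR G (rmx e_vec) (rmx (e_vec *m g)) <= 0.
  by apply: (causal_le0 lorG xx) xe xeg; rewrite bR_rmx lerz0 ?bZ_isometry.
have eg_norm := image_e_norm egE.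
rewrite bR_rmx lerz0 egE bZ_UA2 linear0l /A2_prod => kb.
rewrite lt_neqAle; apply/andP; split; last by nia.
apply: contra_neq normalized_moves_e => b0.
rewrite b0 mulr0 mul0r addr0 mulr0 add0r in eg_norm.
have st_ge0 := A2_norm_ge0 s t; have v_ge0 := posdef_bZ_ge0 v posN.
have /A2_norm_eq0[s0 t0] : A2_norm s t = 0.
  by move: eg_norm st_ge0; rewrite /A2_norm; lia.
have v0 : v = 0.
  by apply: (posdef_bZ_eq0 posN); move: eg_norm; rewrite s0 t0 /A2_norm; lia.
have eg_scale : e_vec *m g = a *: e_vec.
  by rewrite egE UA2_vecZ b0 s0 t0 v0 mulr1 !mulr0 scaler0.
have : 0 < a.
  by move: xeg; rewrite eg_scale map_mxZ bRZr nmulr_llt0 // ltr0z.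
have := image_e_primitive eg_scale; rewrite dvdz1 => a1 a_gt0.
by rewrite eg_scale (_ : a = 1) ?scale1r //; lia.
Qed.

(* The roots [r] with [r.e > 0] pair nonnegatively with the image of [e], so they
   are far from its rescaling by [b^-1]. *)
Lemma image_e_far a b l1 l2 v c m1 m2 w :
  e_vec *m g = UA2_vec a b l1 l2 v ->
  bZ G (UA2_vec c 1 m1 m2 w) (UA2_vec c 1 m1 m2 w) = 2 ->
  2 <= 2 * A2_norm (l1%:~R / b%:~R - m1%:~R) (l2%:~R / b%:~R - m2%:~R) +
    bR N (b%:~R^-1 *: rmx v - rmx w) (b%:~R^-1 *: rmx v - rmx w).
Proof.
move=> egE r2; set y := _ - rmx w; set r := UA2_vec c 1 m1 m2 w in r2.
have b0 := image_e_f_lt0 egE.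
case: (gx) => gG _ _ _ _; have b0R : b%:~R != 0 :> RR by rewrite intr_eq0 lt_eqF.
have rr : root_vec G r by left.
have er : 0 < bZ G e_vec r by rewrite bZ_UA2 linear0l /A2_prod; lia.
have eg_ge0 := normalized_image_e_ge0 lorG gx rr (normalized_root_gt0 gx rr er).
have eg_norm : bR G (rmx (e_vec *m g)) (rmx (e_vec *m g)) = 0.
  by rewrite bR_rmx bZ_isometry // e_vec_isotropic.
pose d := b%:~R^-1 *: rmx (e_vec *m g) - rmx r.
have <- : bR G d d = 2 * A2_norm (l1%:~R / b%:~R - m1%:~R) (l2%:~R / b%:~R - m2%:~R)
    + bR N y y.
  rewrite /d egE !map_UA2_vec UA2_vecZ UA2_vecB bR_UA2 A2_prodxx -/y.
  by rewrite mulVf // subrr mul0r mulr0 addr0 mulr0 add0r ![_^-1 * _]mulrC.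
have -> : bR G d d = 2 - 2 * (b%:~R^-1 * (bZ G (e_vec *m g) r)%:~R).
  rewrite /d linearBl !linearBr /= !bRZl !bRZr eg_norm.
  have [symG _] := lorG; rewrite (bRC (rmx r)) // !bR_rmx r2; ring.
have : b%:~R^-1 * (bZ G (e_vec *m g) r)%:~R <= 0 :> RR.
  by rewrite mulr_le0_ge0 ?ler0z // invr_le0 lerz0 ltW.
by lra.
Qed.

End NormalizedUA2.
End Chirality.

Definition covering_norm_le n (N : 'M[int]_n) (r : RR) := forall y : 'rV[RR]_n,
  exists w : 'rV[int]_n, bR N (y - rmx w) (y - rmx w) <= r.

Lemma chiral_U_A2_osum n (N : 'M[int]_n) : N^T = N -> posdef (rmx N) ->
  even_lattice N -> covering_norm_le N 1 -> chiral (UA2_lattice 1 N).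
Proof.
move=> symN posN evenN coverN; have k0 : (0 < 1)%N by [].
move=> /(achiral_normalized_UA2 k0 symN posN)[g [x gx]].
have [a [b [l1 [l2 [v egE]]]]] := UA2_vec_surj (e_vec n *m g).
have [m1 [m2 A2_close]] := A2_covering (l1%:~R / b%:~R : RR) (l2%:~R / b%:~R).
have [w N_close] := coverN (b%:~R^-1 *: rmx v).
have /dvdzP[q wq] := evenN w; pose c := 1 - q - A2_norm m1 m2.
have r2 : bZ (UA2_lattice 1 N) (UA2_vec c 1 m1 m2 w) (UA2_vec c 1 m1 m2 w) = 2.
  by rewrite bZ_UA2 A2_prodxx wq /c; ring.
by have := image_e_far k0 symN posN gx egE r2; lra.
Qed.

(** * The lattice U(2) + A2 *)

Section Swap.
Variables (n : nat) (N : 'M[int]_n).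

(* The reflection in the vector [e + f] of norm 4 in U(2) *)
Definition swap : 'M[int]_(2 + 2 + n) := osum (osum (- U) 1%:M) 1%:M.

Lemma UA2_vec_swap (a b s t : int) (v : 'rV[int]_n) :
  UA2_vec a b s t v *m swap = UA2_vec (- b) (- a) s t v.
Proof.
rewrite /UA2_vec /swap /osum !mul_row_block !mulmx0 !mulmx1 !addr0 !add0r.
congr (row_mx (row_mx _ _) _); apply/rowP => j.
rewrite !mxE big_ord_recl big_ord1 !mxE /=.
by case: j => [[|[|]]] //= _; rewrite ?oppr0 ?mulr0 ?addr0 ?add0r ?mulrN1.
Qed.

Lemma swap_isometry k : isometry (UA2_lattice k N) swap.
Proof.
apply: isometry_of_bZ => u v.
have [a [b [s [t [w ->]]]]] := UA2_vec_surj u.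
have [a' [b' [s' [t' [w' ->]]]]] := UA2_vec_surj v.
by rewrite !UA2_vec_swap !bZ_UA2; ring.
Qed.

Lemma UA2_swap : UA2_lattice 2 N *m (1%:M - swap) = 2 *: (1%:M - swap).
Proof.
have -> : 1%:M - swap = osum (osum (1%:M + U) 0) 0.
  rewrite /swap /osum !scalar_mx_block !opp_block_mx !add_block_mx !subr0.
  by rewrite !subrr opprK.
rewrite /UA2_lattice /osum !mulmx_block !mulmx0 !mul0mx !addr0 !scale_block_mx !scaler0.
congr (block_mx (block_mx _ _ _ _) _ _ _).
rewrite mulmxDr mulmx1 scalerDr addrC -!scaler_nat -scalemxAl; congr (_ *: _ + _ *: _).
apply/matrixP => -[[|[|]]] // ? [[|[|]]] // ?;
  by rewrite !mxE big_ord_recl big_ord1 !mxE.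
Qed.

Lemma Z3_reversing_swap g :
  Z3_reversing (UA2_lattice 2 N) g -> Z3_reversing (UA2_lattice 2 N) (g *m swap).
Proof.
move=> rg x xd x3; have [z zE] := rg x xd x3.
have [w wE] := Z3_part_integral UA2_swap xd x3.
exists (z *m swap + w); rewrite map_mxD -wE !map_mxM -zE map_mxB map_mx1.
rewrite mulmxDl mulmxBr mulmx1 mulmxA -addrA; congr (_ + _).
by rewrite addrC subrK.
Qed.

End Swap.

Lemma UA2_lattice_dim0 k : UA2_lattice k (0 : 'M[int]_0) = osum (U *+ k) A2.
Proof.
apply/matrixP => i j; rewrite /UA2_lattice {1}/osum.
have -> : i = lshift 0 (i : 'I_(2 + 2)) by apply/val_inj.
have -> : j = lshift 0 (j : 'I_(2 + 2)) by apply/val_inj.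
by rewrite block_mxEul; congr (osum _ _ _ _); exact/val_inj.
Qed.

Lemma bZ_dim0 (N : 'M[int]_0) u v : bZ N u v = 0.
Proof. by rewrite (thinmx0 u) linear0l. Qed.

Lemma bR_dim0 (N : 'M[int]_0) x y : bR N x y = 0.
Proof. by rewrite (thinmx0 x) linear0l. Qed.

Lemma posdef_dim0 (R : realFieldType) (M : 'M[R]_0) : posdef M.
Proof. by move=> v; rewrite (thinmx0 v) eqxx. Qed.

Lemma chiral_U_A2 : chiral (osum U A2).
Proof.
rewrite -[osum _ _](UA2_lattice_dim0 1); apply: chiral_U_A2_osum.
- exact: trmx0.
- exact: posdef_dim0.
- by move=> v; rewrite bZ_dim0.
- by move=> y; exists 0; rewrite bR_dim0.
Qed.

Section U2A2.
Local Notation N := (0 : 'M[int]_0).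
Local Notation G := (UA2_lattice 2 N).
Variables (g : 'M[int]_(2 + 2 + 0)) (x : 'rV[RR]_(2 + 2 + 0)).
Hypothesis gx : normalized G (e_vec 0) (rho_vec 0) g x.

Let k0 : (0 < 2)%N. Proof. by []. Qed.
Let symN : N^T = N. Proof. exact: trmx0. Qed.
Let posN : posdef (rmx N). Proof. exact: posdef_dim0. Qed.
Let lorG : lorentzian G. Proof. exact: UA2_lorentzian. Qed.

(* The roots [c e + f + m] exist exactly for the vectors [m] of A2 outside 2 A2. *)
Lemma U2_A2_image_e_even a b l1 l2 v : e_vec 0 *m g = UA2_vec a b l1 l2 v ->
  exists s t, l1 = 2 * s * b /\ l2 = 2 * t * b.
Proof.
move=> egE; have b0 := image_e_f_lt0 k0 symN posN gx egE.
have b0R : b%:~R != 0 :> RR by rewrite intr_eq0 lt_eqF.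
case: (A2_covering_odd (l1%:~R / b%:~R : RR) (l2%:~R / b%:~R)).
  move=> [m1 [m2 [/A2_norm_odd[q mq] close]]].
  have r2 : bZ G (UA2_vec (- q) 1 m1 m2 0) (UA2_vec (- q) 1 m1 m2 0) = 2.
    by rewrite bZ_UA2 A2_prodxx mq linear0l; ring.
  by have := image_e_far k0 symN posN gx egE r2; rewrite bR_dim0; lra.
move=> [s [t [/(canRL (divfK b0R)) l1E /(canRL (divfK b0R)) l2E]]].
by exists s, t; split; apply: (@intr_inj RR); rewrite !intrM.
Qed.

Lemma U2_A2_image_e : e_vec 0 *m g = UA2_vec 0 (-1) 0 0 0.
Proof.
have [a [b [l1 [l2 [v egE]]]]] := UA2_vec_surj (e_vec 0 *m g).
have b0 := image_e_f_lt0 k0 symN posN gx egE.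
have [s [t [l1E l2E]]] := U2_A2_image_e_even egE.
move: egE; rewrite (thinmx0 v) {}l1E {}l2E => egE.
have aE : a = - 2 * b * A2_norm s t.
  have eg_norm := image_e_norm k0 symN posN gx egE; rewrite linear0l in eg_norm.
  by apply: (mulIf (ltr0_neq0 b0)); move: eg_norm; rewrite /A2_norm; lia.
have b1 : b = -1.
  have : (b %| 1)%Z.
    apply: (image_e_primitive k0 symN posN gx
      (u := UA2_vec (- 2 * A2_norm s t) 1 (2 * s) (2 * t) 0)).
    by rewrite egE UA2_vecZ scaler0 aE; congr UA2_vec; ring.
  by rewrite dvdz1; lia.
have wall_ge0 r : r \in alcove_walls 0 -> 0 <= bZ G (e_vec 0 *m g) r.
  move=> rW; apply: (normalized_image_e_ge0 lorG gx (alcove_walls_root 2 N rW)).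
  exact: (normalized_alcove k0 symN posN gx rW).
have wall i : (i < 3)%N -> 0 <= bZ G (e_vec 0 *m g) (nth 0 (alcove_walls 0) i).
  by move=> i3; exact/wall_ge0/mem_nth.
have := wall 0%N isT; have := wall 1%N isT; have := wall 2%N isT.
rewrite egE /= !bZ_UA2 !bZ_dim0 b1 /A2_prod => w3 w2 w1.
have s0 : s = 0 by lia.
have t0 : t = 0 by lia.
by congr UA2_vec; rewrite ?aE ?s0 ?t0 ?b1.
Qed.

Lemma U2_A2_alcove_swap : alcove 2 N (x *m rmx (g *m swap 0)).
Proof.
have swap_bR u : bR G (x *m rmx (g *m swap 0)) (rmx (u *m swap 0)) =
    bR G (x *m rmx g) (rmx u).
  by rewrite !map_mxM mulmxA bR_isometry //; exact: swap_isometry.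
have wall i : (i < 3)%N -> 0 < bR G (x *m rmx g) (rmx (nth 0 (alcove_walls 0) i)).
  by move=> i3; exact/(normalized_alcove_image k0 symN posN gx)/mem_nth.
move=> r; rewrite !inE => /or3P[]/eqP->.
- rewrite -[a2_vec 0]/(UA2_vec (- 0) (- 0) 0 1 0) -UA2_vec_swap swap_bR.
  exact: wall 0%N isT.
- by have := wall 1%N isT; rewrite -swap_bR UA2_vec_swap oppr0.
have -> : UA2_vec (-1) 0 (-1) (-1) 0 = UA2_vec 0 1 (-1) (-1) 0 *m swap 0.
  by rewrite UA2_vec_swap oppr0.
rewrite swap_bR; have f_root : root_vec G (UA2_vec 0 1 (-1) (-1) 0).
  by left; rewrite bZ_UA2 bZ_dim0 /A2_prod; lia.
apply: (normalized_image_gt0 gx f_root); apply: (normalized_root_gt0 gx f_root).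
by rewrite bZ_UA2 bZ_dim0 /A2_prod; lia.
Qed.

End U2A2.

Lemma chiral_U2_A2 : chiral (osum (scale2 U) A2).
Proof.
have k0 : (0 < 2)%N by [].
have symN : (0 : 'M[int]_0)^T = 0 := trmx0 _ _ _.
have posN : posdef (rmx (0 : 'M[int]_0)) := @posdef_dim0 _ _.
rewrite -[osum _ _](UA2_lattice_dim0 2) => /(achiral_normalized_UA2 k0 symN posN).
move=> [g [x gx]]; case: (gx) => gG rg _ _ _.
have ge : e_vec 0 *m (g *m swap 0) = e_vec 0.
  by rewrite mulmxA (U2_A2_image_e gx) UA2_vec_swap oppr0 opprK.
exact: (alcove_not_reversing symN posN k0 (isometryM gG (swap_isometry _ _))
  (Z3_reversing_swap rg) ge (normalized_alcove k0 symN posN gx)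
  (U2_A2_alcove_swap gx)).
Qed.

(** * Matrices as lists of rows *)

(* Identities between matrices given by lists of rows reduce to computations on
   closed lists of integers. *)
Definition entry (s : seq (seq int)) i j := nth 0 (nth [::] s i) j.

Definition seqmx m n (s : seq (seq int)) : 'M[int]_(m, n) :=
  \matrix_(i, j) entry s i j.

Definition mkseqmx m n (f : nat -> nat -> int) : seq (seq int) :=
  mkseq (fun i => mkseq (f i) n) m.

Lemma seqmx_mkseqmx m n f : seqmx m n (mkseqmx m n f) = \matrix_(i, j) f i j.
Proof. by apply/matrixP => i j; rewrite !mxE /entry !nth_mkseq. Qed.

Lemma eq_seqmx m n s t : s == t -> seqmx m n s = seqmx m n t.
Proof. by move=> /eqP->. Qed.

Definition mulseqmx m n p s t := mkseqmx m p (fun i j =>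
  foldr (fun l c => entry s i l * entry t l j + c) 0 (iota 0 n)).

Lemma seqmxM m n p s t : seqmx m n s *m seqmx n p t = seqmx m p (mulseqmx m n p s t).
Proof.
rewrite seqmx_mkseqmx; apply/matrixP => i j; rewrite !mxE.
under eq_bigr do rewrite !mxE.
rewrite -(big_mkord xpredT (fun l => entry s i l * entry t l j)) /index_iota subn0.
by rewrite unlock; elim: (iota 0 n) => //= l r ->.
Qed.

Definition trseqmx m n s := mkseqmx m n (fun i j => entry s j i).

Lemma seqmx_tr m n s : (seqmx m n s)^T = seqmx n m (trseqmx n m s).
Proof. by rewrite seqmx_mkseqmx; apply/matrixP => i j; rewrite !mxE. Qed.

Definition subseqmx m n s t := mkseqmx m n (fun i j => entry s i j - entry t i j).

Lemma seqmxB m n s t : seqmx m n s - seqmx m n t = seqmx m n (subseqmx m n s t).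
Proof. by rewrite seqmx_mkseqmx; apply/matrixP => i j; rewrite !mxE. Qed.

Definition scaleseqmx c m n s := mkseqmx m n (fun i j => c * entry s i j).

Lemma seqmxZ c m n s : c *: seqmx m n s = seqmx m n (scaleseqmx c m n s).
Proof. by rewrite seqmx_mkseqmx; apply/matrixP => i j; rewrite !mxE. Qed.

Definition scalarseqmx c n := mkseqmx n n (fun i j => if i == j then c else 0).

Lemma seqmx_scalar c n : c%:M = seqmx n n (scalarseqmx c n).
Proof.
rewrite seqmx_mkseqmx; apply/matrixP => i j; rewrite !mxE -[i == j :> nat]/(i == j).
by case: eqP.
Qed.

Definition osumseqmx m n s t := mkseqmx (m + n) (m + n) (fun i j =>
  if (i < m)%N then if (j < m)%N then entry s i j else 0
  else if (j < m)%N then 0 else entry t (i - m) (j - m)).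

Lemma seqmx_osum m n s t :
  osum (seqmx m m s) (seqmx n n t) = seqmx (m + n) (m + n) (osumseqmx m n s t).
Proof.
rewrite seqmx_mkseqmx; apply/matrixP => i j; rewrite [RHS]mxE.
case: (split_ordP i) => i' ->; case: (split_ordP j) => j' ->.
- by rewrite block_mxEul !mxE.
- by rewrite block_mxEur !mxE.
- by rewrite block_mxEdl !mxE.
- by rewrite block_mxEdr !mxE /= !addKn.
Qed.

Definition cartanseqmx n (s : seq (nat * nat)) := mkseqmx n n (fun i j =>
  if i == j then 2 else if ((i, j) \in s) || ((j, i) \in s) then -1 else 0).

Lemma seqmx_cartan n s : cartan (@edges n s) = seqmx n n (cartanseqmx n s).
Proof. by rewrite seqmx_mkseqmx; apply/matrixP => i j; rewrite !mxE. Qed.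

Lemma seqmx_U : U = seqmx 2 2 [:: [:: 0; 1]; [:: 1; 0]].
Proof. by apply/matrixP => -[[|[|]]] // ? [[|[|]]] // ?; rewrite !mxE. Qed.

Lemma seqmx_scale2 n s : scale2 (seqmx n n s) = seqmx n n (scaleseqmx 2 n n s).
Proof. by rewrite /scale2 -scaler_nat seqmxZ. Qed.

(** * Covering radii of D4 and E8 *)

Section IntegerDistance.
Variable R : realType.
Implicit Types t : R.

Definition int_dist t : R :=
  Num.min (t - (Num.floor t)%:~R) (1 - (t - (Num.floor t)%:~R)).

Lemma int_dist_itv t : 0 <= int_dist t <= 1 / 2.
Proof.
have := floor_itv t; rewrite /int_dist intrD; move: (Num.floor t)%:~R => m /andP[m0 m1].
by have [h|h] := leP (t - m) (1 - (t - m)); apply/andP; split; lra.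
Qed.

Lemma int_dist_sub_half t : int_dist (t - 1 / 2) = 1 / 2 - int_dist t.
Proof.
have := floor_itv t; rewrite /int_dist intrD => /andP[m0 m1].
have floorE (c : int) : c%:~R <= t - 1 / 2 < (c + 1)%:~R -> Num.floor (t - 1 / 2) = c.
  exact: floor_def.
have [h|h] := ltP (t - (Num.floor t)%:~R) (1 / 2).
  have -> : Num.floor (t - 1 / 2) = Num.floor t - 1.
    by apply: floorE; rewrite subrK intrB; apply/andP; split; lra.
  rewrite intrB; move: (Num.floor t)%:~R m0 m1 h => m m0 m1 h.
  by rewrite min_r; [rewrite min_l|]; lra.
have -> : Num.floor (t - 1 / 2) = Num.floor t.
  by apply: floorE; rewrite intrD; apply/andP; split; lra.
move: (Num.floor t)%:~R m0 m1 h => m m0 m1 h.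
by rewrite min_l; [rewrite min_r|]; lra.
Qed.

Lemma nearest_ints t : exists m e : int, [/\ e = 1 \/ e = -1,
  (t - m%:~R) ^+ 2 = int_dist t ^+ 2 &
  (t - (m + e)%:~R) ^+ 2 = (1 - int_dist t) ^+ 2].
Proof.
rewrite /int_dist.
have [h|h] := leP (t - (Num.floor t)%:~R) (1 - (t - (Num.floor t)%:~R)).
  by exists (Num.floor t), 1; split; [left | | rewrite intrD; ring].
exists (Num.floor t + 1), (-1); split; [by right | rewrite intrD; ring |].
by rewrite addrK; ring.
Qed.

(* Rounding each coordinate yields a point of Z^n; if its coordinate sum is odd,
   the coordinate [i0] is rounded the other way. *)
Lemma even_sum_rounding n (z : 'I_n -> R) (i0 : 'I_n) :
  exists2 V : 'I_n -> int, (2 %| \sum_i V i)%Z &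
  \sum_i (z i - (V i)%:~R) ^+ 2 = \sum_i int_dist (z i) ^+ 2 \/
  \sum_i (z i - (V i)%:~R) ^+ 2 =
    \sum_i int_dist (z i) ^+ 2 + 1 - 2 * int_dist (z i0).
Proof.
have /choice[m mP] := fun i => nearest_ints (z i).
have mE i : (z i - (m i)%:~R) ^+ 2 = int_dist (z i) ^+ 2 by have [e []] := mP i.
have [ev|od] := boolP (2 %| \sum_i m i)%Z.
  by exists m => //; left; apply: eq_bigr.
have [e [eP _ m0E]] := mP i0.
pose V i := if i == i0 then m i + e else m i.
have VE i : i != i0 -> V i = m i by rewrite /V => /negPf->.
have V0 : V i0 = m i0 + e by rewrite /V eqxx.
exists V.
  have -> : \sum_i V i = \sum_i m i + e.
    by rewrite (bigD1 i0) //= (eq_bigr _ VE) V0 [in RHS](bigD1 i0) //= addrAC.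
  by case: eP => ->; lia.
right; rewrite (bigD1 i0) //= V0 m0E [in RHS](bigD1 i0) //=.
rewrite (eq_bigr (fun i => int_dist (z i) ^+ 2)) => [|i /VE->//]; ring.
Qed.

Lemma sum_sqr_le (I : finType) (d : I -> R) (a b : R) :
  (forall i, a <= d i <= b) ->
  \sum_i d i ^+ 2 <= (a + b) * \sum_i d i - #|I|%:R * (a * b).
Proof.
move=> ab; have -> : (a + b) * \sum_i d i - #|I|%:R * (a * b) =
    \sum_i ((a + b) * d i - a * b).
  by rewrite big_split /= -mulr_sumr sumr_const mulr_natl mulNrn.
apply: ler_sum => i _; have /andP[ad db] := ab i; rewrite -subr_ge0.
have -> : (a + b) * d i - a * b - d i ^+ 2 = (d i - a) * (b - d i) by ring.
by apply: mulr_ge0; lra.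
Qed.

Lemma sum_bounds (I : finType) (d : I -> R) (a b : R) : (forall i, a <= d i <= b) ->
  #|I|%:R * a <= \sum_i d i <= #|I|%:R * b.
Proof.
move=> ab; have cst c : #|I|%:R * c = \sum_(i in I) c :> R.
  by rewrite sumr_const mulr_natl.
by rewrite !cst; apply/andP; split; apply: ler_sum => i _; have /andP[] := ab i.
Qed.

Lemma D4_coord_covering (z : 'I_4 -> R) : exists2 V : 'I_4 -> int,
  (2 %| \sum_i V i)%Z & \sum_i (z i - (V i)%:~R) ^+ 2 <= 1.
Proof.
pose d i := int_dist (z i).
have [i1 _ d_max] := @arg_maxP _ _ _ (ord0 : 'I_4) xpredT d isT.
have [V evV sumV] := even_sum_rounding z i1; exists V => //.
have d_itv i : 0 <= d i <= d i1.
  by have /andP[-> _] := int_dist_itv (z i); exact: d_max.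
have /andP[b0 b1] := int_dist_itv (z i1).
have := sum_sqr_le d_itv; have := sum_bounds d_itv; rewrite card_ord.
case: sumV => ->; rewrite -/(d i1) in b0 b1 *; move: (\sum_i d i ^+ 2) (\sum_i d i);
  by move: (d i1) b0 b1 => b b0 b1 N S /andP[_ S4] NS; nra.
Qed.

(* [N] and [S] are the sums of the d_i^2 and d_i, where d_i in [a, b] is the
   distance from z_i to the integers; [x] and [y] are the squared distances from z
   to the points of D8 and of its translate found by rounding. *)
Lemma E8_rounding_le1 (N S a b x y : R) : 0 <= a -> a <= b -> b <= 1 / 2 ->
  8 * a <= S <= 8 * b ->
  N <= (a + b) * S - 8 * (a * b) -> N <= (a + 1 / 2) * S - 8 * (a * (1 / 2)) ->
  N <= b * S -> N <= 1 / 2 * S ->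
  x = N \/ x = N + 1 - 2 * b -> y = N - S + 2 \/ y = N - S + 2 + 2 * a ->
  1 < x -> y <= 1.
Proof.
move=> a0 ab b1 /andP[S1 S2] Nab Na Nb NS xE yE x1; rewrite leNgt; apply/negP => y1.
case: xE yE => xE [] yE; rewrite {x}xE {y}yE in x1 y1.
- lra.
- have [lt_half|ge_half] := ltP a (1 / 2); last by nra.
  have : N * (1 / 2 - a) <= 2 * (1 / 2 - a) * (1 / 2 - a) by nra.
  nra.
- nra.
- have [lt_half|ge_half] := ltP (a + b) 1; last by nra.
  have N_ub : N * (1 - a - b) <= (a + b) * (1 + 2 * a) - 8 * (a * b) by nra.
  have N_lb : 2 * b * (1 - a - b) < N * (1 - a - b) by rewrite ltr_pM2r; lra.
  have : 0 <= (b - a) * (1 - 2 * (b - a)) by apply: mulr_ge0; lra.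
  nra.
Qed.

(* E8 is the union of D8 and its translate by the vector (1/2, ..., 1/2). *)
Lemma E8_coord_covering (z : 'I_8 -> R) : exists (c : int) (V : 'I_8 -> int),
  (2 %| \sum_i V i)%Z /\ \sum_i (z i - (V i)%:~R - c%:~R / 2) ^+ 2 <= 1.
Proof.
pose d i := int_dist (z i).
have [i1 _ d_max] := @arg_maxP _ _ _ (ord0 : 'I_8) xpredT d isT.
have [i0 _ d_min] := @arg_minP _ _ _ (ord0 : 'I_8) xpredT d isT.
have [V evV sumV] := even_sum_rounding z i1.
have [W evW sumW] := even_sum_rounding (fun i => z i - 1 / 2) i0.
have [le1|gt1] := leP (\sum_i (z i - (V i)%:~R) ^+ 2) 1.
  exists 0, V; split=> //; apply: le_trans le1; apply: ler_sum => i _.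
  by rewrite mul0r subr0.
exists 1, W; split=> //.
have -> : \sum_i (z i - (W i)%:~R - 1%:~R / 2) ^+ 2 =
    \sum_i (z i - 1 / 2 - (W i)%:~R) ^+ 2.
  by apply: eq_bigr => i _; rewrite mulr1z addrAC.
have shifted : \sum_i int_dist (z i - 1 / 2) ^+ 2 =
    \sum_i d i ^+ 2 - \sum_i d i + 2.
  transitivity (\sum_i (d i ^+ 2 - d i + 1 / 4)).
    by apply: eq_bigr => i _; rewrite int_dist_sub_half -/(d i); field.
  by rewrite big_split sumrB /= sumr_const card_ord -mulr_natl; field.
rewrite shifted int_dist_sub_half -/(d i0) in sumW.
have d_half i : 0 <= d i <= 1 / 2 by exact: int_dist_itv.
have d_ab i : d i0 <= d i <= d i1 by apply/andP; split; [exact: d_min | exact: d_max].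
have d_a i : d i0 <= d i <= 1 / 2.
  by have /andP[_ ->] := d_half i; rewrite andbT; exact: d_min.
have d_b i : 0 <= d i <= d i1 by have /andP[-> _] := d_half i; exact: d_max.
have := sum_bounds d_ab; have := sum_sqr_le d_ab; have := sum_sqr_le d_a.
have := sum_sqr_le d_b; have := sum_sqr_le d_half; rewrite card_ord.
rewrite !mul0r !mulr0 !subr0 !add0r => N4 N3 N2 N1 S12.
have /andP[a0 _] := d_half i0; have /andP[_ b1] := d_half i1.
apply: (E8_rounding_le1 a0 (d_min i1 isT) b1 S12 N1 N2 N3 N4 sumV _ gt1).
by case: sumW => ->; [left | right; lra].
Qed.

End IntegerDistance.

Section Factorization.
Variables (m n c : nat) (N : 'M[int]_m) (B : 'M[int]_(m, n)).
Hypotheses (c0 : (0 < c)%N) (NB : (c ^ 2)%:R *: N = B *m B^T).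

Lemma bR_factor (v : 'rV[RR]_m) :
  bR N v v = \sum_j ((v *m rmx B) 0 j / c%:R) ^+ 2.
Proof.
have cR : c%:R != 0 :> RR by rewrite pnatr_eq0 -lt0n.
apply: (mulfI (_ : (c ^ 2)%:R != 0 :> RR)); first by rewrite natrX expf_neq0.
have BB : rmx B *m (rmx B)^T = (c ^ 2)%:R *: rmx N.
  by rewrite map_trmx -map_mxM -NB map_mxZ rmorph_nat.
have -> : (c ^ 2)%:R * bR N v v = ((v *m rmx B) *m (v *m rmx B)^T) 0 0.
  rewrite trmx_mul -!mulmxA (mulmxA (rmx B)) BB -scalemxAl -scalemxAr [RHS]mxE.
  by rewrite mulmxA.
rewrite mxE mulr_sumr; apply: eq_bigr => j _; rewrite [_^T _ _]mxE natrX expr_div_n.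
by rewrite -expr2; field.
Qed.

Lemma bR_factor_sub (y : 'rV[RR]_m) (w : 'rV[int]_m) :
  bR N (y - rmx w) (y - rmx w) =
  \sum_j ((y *m rmx B) 0 j / c%:R - ((w *m B) 0 j)%:~R / c%:R) ^+ 2.
Proof.
rewrite bR_factor; apply: eq_bigr => j _; congr (_ ^+ 2).
by rewrite mulmxBl -map_mxM mxE [X in _ + X]mxE [X in - X]mxE mulrBl.
Qed.

Lemma posdef_of_factor (S : 'M[int]_m) (d : int) :
  N *m S = d%:M -> d != 0 -> posdef (rmx N).
Proof.
move=> NS d0 v v0; rewrite -[gram_form _ _ _]/(bR N v v) bR_factor.
have sqr_ge j : true -> 0 <= ((v *m rmx B) 0 j / c%:R) ^+ 2 by rewrite sqr_ge0.
rewrite lt_neqAle sumr_ge0 // andbT eq_sym; apply: contra_neq v0 => sum0.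
have cR : c%:R != 0 :> RR by rewrite pnatr_eq0 -lt0n.
have vB : v *m rmx B = 0.
  apply/rowP => j; rewrite [RHS]mxE; apply/eqP.
  have /eqP : ((v *m rmx B) 0 j / c%:R) ^+ 2 = 0 by exact: (psumr_eq0P sqr_ge sum0).
  by rewrite sqrf_eq0 mulf_eq0 invr_eq0 (negPf cR) orbF.
have vN : v *m rmx N = 0.
  apply: (scalerI (_ : (c ^ 2)%:R != 0 :> RR)).
    by rewrite pnatr_eq0 expn_eq0 gtn_eqF.
  rewrite scaler0 scalemxAr -[(c ^ 2)%:R](rmorph_nat (intr : int -> RR)) -map_mxZ NB.
  by rewrite map_mxM mulmxA vB mul0mx.
have : v *m rmx N *m rmx S = d%:~R *: v.
  by rewrite -mulmxA -map_mxM NS map_scalar_mx mul_mx_scalar.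
by rewrite vN mul0mx => /esym/eqP; rewrite scaler_eq0 intr_eq0 (negPf d0) => /eqP.
Qed.

End Factorization.

(* The vectors of even coordinate sum are spanned by the [e_i - e_0] and [2 e_0]. *)
Lemma even_sum_in_row_span m n c (B : 'M[int]_(m, n.+1)) (Q : 'M[int]_(n.+1, m))
    (q : 'rV[int]_m) (V : 'I_n.+1 -> int) :
  Q *m B = \matrix_(i, j) (c * ((i == j)%:R - (j == 0)%:R)) ->
  q *m B = \row_j (2 * c * (j == 0)%:R) -> (2 %| \sum_i V i)%Z ->
  exists w : 'rV[int]_m, w *m B = c *: \row_j V j.
Proof.
move=> QB qB /dvdzP[h Vh]; exists ((\row_j V j) *m Q + h *: q).
apply/rowP => j; rewrite mulmxDl -mulmxA QB -scalemxAl qB !mxE.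
under eq_bigr do rewrite !mxE.
have -> : \sum_i V i * (c * ((i == j)%:R - (j == 0)%:R)) =
    c * (V j - (j == 0)%:R * (h * 2)).
  rewrite -Vh; transitivity (\sum_i (c * ((i == j)%:R * V i) - c * (j == 0)%:R * V i)).
    by apply: eq_bigr => i _; ring.
  rewrite sumrB -!mulr_sumr (bigD1 j) //= eqxx mul1r big1 => [|i /negPf->].
    by rewrite addr0 -mulrA -mulrBr.
  by rewrite mul0r.
by ring.
Qed.

Definition D4_coords : seq (seq int) :=
  [:: [:: 1; -1; 0; 0]; [:: 0; 1; -1; 0]; [:: 0; 0; 1; -1]; [:: 0; 0; 1; 1]].
(* Twice the simple roots of E8 in orthonormal coordinates *)
Definition E8_coords : seq (seq int) :=
  [:: [:: 1; -1; -1; -1; -1; -1; -1; 1]; [:: 2; 2; 0; 0; 0; 0; 0; 0];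
      [:: -2; 2; 0; 0; 0; 0; 0; 0]; [:: 0; -2; 2; 0; 0; 0; 0; 0];
      [:: 0; 0; -2; 2; 0; 0; 0; 0]; [:: 0; 0; 0; -2; 2; 0; 0; 0];
      [:: 0; 0; 0; 0; -2; 2; 0; 0]; [:: 0; 0; 0; 0; 0; -2; 2; 0]].
Definition D4_inv2 : seq (seq int) :=
  [:: [:: 2; 2; 1; 1]; [:: 2; 4; 2; 2]; [:: 1; 2; 2; 1]; [:: 1; 2; 1; 2]].
Definition E8_inv : seq (seq int) :=
  [:: [:: 4; 5; 7; 10; 8; 6; 4; 2]; [:: 5; 8; 10; 15; 12; 9; 6; 3];
      [:: 7; 10; 14; 20; 16; 12; 8; 4]; [:: 10; 15; 20; 30; 24; 18; 12; 6];
      [:: 8; 12; 16; 24; 20; 15; 10; 5]; [:: 6; 9; 12; 18; 15; 12; 8; 4];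
      [:: 4; 6; 8; 12; 10; 8; 6; 3]; [:: 2; 3; 4; 6; 5; 4; 3; 2]].

Lemma D4_factor : (1 ^ 2)%:R *: D4 = seqmx 4 4 D4_coords *m (seqmx 4 4 D4_coords)^T.
Proof.
by rewrite /D4 seqmx_cartan seqmxZ seqmx_tr seqmxM; apply: eq_seqmx; vm_compute.
Qed.

Lemma E8_factor : (2 ^ 2)%:R *: E8 = seqmx 8 8 E8_coords *m (seqmx 8 8 E8_coords)^T.
Proof.
by rewrite /E8 seqmx_cartan seqmxZ seqmx_tr seqmxM; apply: eq_seqmx; vm_compute.
Qed.

Lemma D4_mul_inv2 : D4 *m seqmx 4 4 D4_inv2 = 2%:M.
Proof.
by rewrite /D4 seqmx_cartan seqmxM seqmx_scalar; apply: eq_seqmx; vm_compute.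
Qed.

Lemma E8_mul_inv : E8 *m seqmx 8 8 E8_inv = 1%:M.
Proof.
by rewrite /E8 seqmx_cartan seqmxM seqmx_scalar; apply: eq_seqmx; vm_compute.
Qed.

Lemma D4_posdef : posdef (rmx D4).
Proof. exact: (@posdef_of_factor _ _ 1 _ _ isT D4_factor _ _ D4_mul_inv2). Qed.

Lemma E8_posdef : posdef (rmx E8).
Proof. exact: (@posdef_of_factor _ _ 2 _ _ isT E8_factor _ _ E8_mul_inv). Qed.

Lemma D4_covering : covering_norm_le D4 1.
Proof.
move=> y; pose B := seqmx 4 4 D4_coords.
have [V evV close] := D4_coord_covering (fun j => (y *m rmx B) 0 j / 1%:R).
have [w wB] : exists w : 'rV[int]_4, w *m B = 1 *: \row_j V j.
  apply: (even_sum_in_row_span (Q := seqmx 4 4 [:: [:: 0; 0; 0; 0]; [:: -1; 0; 0; 0];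
    [:: -1; -1; 0; 0]; [:: -1; -1; -1; 0]]) (q := seqmx 1 4 [:: [:: 2; 2; 1; 1]])) evV.
  - rewrite -(seqmx_mkseqmx 4 4 (fun i j => 1 * ((i == j)%:R - (j == 0%N)%:R))).
    by rewrite seqmxM; apply: eq_seqmx; vm_compute.
  rewrite -(seqmx_mkseqmx 1 4 (fun _ j => 2 * 1 * (j == 0%N)%:R)) seqmxM.
  by apply: eq_seqmx; vm_compute.
exists w; rewrite (bR_factor_sub (c := 1) isT D4_factor) wB.
apply: le_trans close.
by apply: ler_sum => j _; rewrite scale1r [(\row__ _) _ _]mxE [X in _ - X]divr1 lexx.
Qed.

Lemma E8_covering : covering_norm_le E8 1.
Proof.
move=> y; pose B := seqmx 8 8 E8_coords.
have [c [V [evV close]]] := E8_coord_covering (fun j => (y *m rmx B) 0 j / 2%:R).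
have [w wB] : exists w : 'rV[int]_8, w *m B = 2 *: \row_j V j.
  apply: (even_sum_in_row_span (Q := seqmx 8 8 [:: [:: 0; 0; 0; 0; 0; 0; 0; 0];
    [:: 0; 0; 1; 0; 0; 0; 0; 0]; [:: 0; 0; 1; 1; 0; 0; 0; 0];
    [:: 0; 0; 1; 1; 1; 0; 0; 0]; [:: 0; 0; 1; 1; 1; 1; 0; 0];
    [:: 0; 0; 1; 1; 1; 1; 1; 0]; [:: 0; 0; 1; 1; 1; 1; 1; 1];
    [:: 2; 2; 4; 5; 4; 3; 2; 1]])
    (q := seqmx 1 8 [:: [:: 0; 1; -1; 0; 0; 0; 0; 0]])) evV.
  - rewrite -(seqmx_mkseqmx 8 8 (fun i j => 2 * ((i == j)%:R - (j == 0%N)%:R))).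
    by rewrite seqmxM; apply: eq_seqmx; vm_compute.
  rewrite -(seqmx_mkseqmx 1 8 (fun _ j => 2 * 2 * (j == 0%N)%:R)) seqmxM.
  by apply: eq_seqmx; vm_compute.
pose h := seqmx 1 8 [:: [:: 1; 3; 3; 5; 4; 3; 2; 1]].
have hB : h *m B = const_mx 1.
  have -> : const_mx 1 = \matrix_(i < 1, j < 8) (1 : int).
    by apply/matrixP => i j; rewrite !mxE.
  rewrite -(seqmx_mkseqmx 1 8 (fun _ _ => 1)) seqmxM.
  by apply: eq_seqmx; vm_compute.
exists (w + c *: h); rewrite (bR_factor_sub (c := 2) isT E8_factor).
apply: le_trans close; apply: ler_sum => j _; rewrite mulmxDl -scalemxAl wB hB !mxE mulr1 intrD intrM.
rewrite (mulrC 2%:~R) mulrDl mulfK // opprD addrA; exact: lexx.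
Qed.

Lemma chiral_U_A2_D4 : chiral (osum (osum U A2) D4).
Proof.
exact: (chiral_U_A2_osum (cartan_sym _) D4_posdef (cartan_even _) D4_covering).
Qed.

Lemma chiral_U_A2_E8 : chiral (osum (osum U A2) E8).
Proof.
exact: (chiral_U_A2_osum (cartan_sym _) E8_posdef (cartan_even _) E8_covering).
Qed.

(** * Achirality *)

Lemma exists_notin_countable (R : realType) (d : R) (A : set R) :
  0 < d -> countable A -> exists2 t, 0 < t < d & ~ A t.
Proof.
move=> d0 cA; apply: contrapT => no.
have sub : [set` `]0, d[] `<=` A.
  move=> t /=; rewrite in_itv /= => td; apply: contrapT => At; apply: no.
  by exists t.
have := countable_lebesgue_measure0 (sub_countable (subset_card_le sub) cA).
by rewrite lebesgue_measure_itv /= lte_fin d0 sube0 => -[] d1; move: d0; rewrite d1 ltxx.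
Qed.

Lemma exists_common_nonroot (R : realType) (I : countType) (q : {poly R})
    (p : I -> {poly R}) : q.[0] < 0 ->
  exists2 t, q.[t] < 0 & forall i, p i != 0 -> (p i).[t] != 0.
Proof.
move=> q0; have [d d0 qd] : exists2 d : R, 0 < d & forall t, 0 < t < d -> q.[t] < 0.
  have := (@continuous_horner _ q) 0 => /cvgr_lt /(_ _ q0).
  rewrite /= -nbhs_ballE => -[d /= d0 qd]; exists d => // t /andP[t0 td].
  by apply: qd; rewrite /ball /= sub0r normrN gtr0_norm.
pose bad := \bigcup_(i in [set i | p i != 0]) [set t | root (p i) t].
have bad_countable : countable bad.
  apply: bigcup_countable => [|i /= pi0]; first exact: countableP.
  apply: (@sub_countable _ _ _ [set` rootsR (p i)]).
    by apply: subset_card_le => t /= pt; rewrite -(roots_on_rootsR pi0).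
  exact/finite_set_countable/finite_seq.
have [t /qd qt tbad] := exists_notin_countable d0 bad_countable.
by exists t => // i pi0; apply/negP => pt; apply: tbad; exists i.
Qed.

(* The moment curve through [u]: a nonzero linear form takes on it the values of
   a nonzero polynomial in the parameter. *)
Definition moment_curve (R : nzRingType) n (u : 'rV[R]_n) (i : 'I_n) : {poly R} :=
  (u 0 i)%:P + 'X^(i.+1).

Lemma moment_curve_form_neq0 (R : nzRingType) n (u : 'rV[R]_n) (w : 'cV[R]_n) :
  w != 0 -> \sum_i moment_curve u i * (w i 0)%:P != 0.
Proof.
apply: contra_neq => form0; apply/colP => j; rewrite [RHS]mxE.
have := congr1 (fun q : {poly R} => q`_j.+1) form0.
rewrite coef0 coef_sum (bigD1 j) //= big1 => [|i ij].
  by rewrite coefMC coefD coefC coefXn eqxx /= add0r addr0 mul1r.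
have ji : (j.+1 == i.+1) = false by rewrite eqSS eq_sym; exact: negPf.
by rewrite coefMC coefD coefC coefXn ji addr0 mul0r.
Qed.

Lemma exists_generic_point n (G h : 'M[int]_n) (u : 'rV[int]_n) :
  bZ G (u *m h) (u *m h) < 0 ->
  exists2 y : 'rV[RR]_n, bR G (y *m rmx h) (y *m rmx h) < 0 &
  forall v : 'rV[int]_n, h *m G *m v^T != 0 -> bR G (y *m rmx h) (rmx v) != 0.
Proof.
pose X := moment_curve (rmx u); pose x t : 'rV[RR]_n := \row_i (X i).[t].
pose A := rmx (h *m G *m h^T).
pose q : {poly RR} := \sum_j (\sum_i X i * (A i j)%:P) * X j.
have qE t : bR G (x t *m rmx h) (x t *m rmx h) = q.[t].
  transitivity ((x t *m A *m (x t)^T) 0 0).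
    by rewrite /bR /A !map_mxM trmx_mul map_trmx !mulmxA.
  rewrite /q horner_sum mxE; apply: eq_bigr => j _.
  rewrite hornerM !mxE horner_sum; congr (_ * _).
  by apply: eq_bigr => i _; rewrite hornerM hornerC !mxE.
pose p (v : 'rV[int]_n) : {poly RR} :=
  \sum_i X i * (rmx (h *m G *m v^T) i 0)%:P.
have pE v t : bR G (x t *m rmx h) (rmx v) = (p v).[t].
  transitivity ((x t *m rmx (h *m G *m v^T)) 0 0).
    by rewrite /bR !map_mxM map_trmx !mulmxA.
  rewrite horner_sum mxE; apply: eq_bigr => i _.
  by rewrite hornerM hornerC [x t 0 i]mxE.
move=> uh; have q0 : q.[0] < 0.
  rewrite -qE (_ : x 0 = rmx u) -?map_mxM ?bR_rmx ?ltrz0 //.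
  by apply/rowP => i; rewrite !mxE hornerD hornerC hornerXn expr0n /= addr0 mxE.
have [t tq tp] := exists_common_nonroot p q0.
exists (x t) => [|v hv]; rewrite ?qE ?pE //; apply: tp.
by apply: moment_curve_form_neq0; rewrite rmx_eq0.
Qed.

Lemma involution_direct n (G g : 'M[int]_n) (x : 'rV[RR]_n) : \det G != 0 ->
  isometry G g -> g *m g = 1%:M -> x *m rmx g = x -> cone_minus_mirrors G x ->
  exists P, lifted_cell G P /\ direct g P.
Proof.
move=> detG gG gg xg Ax; set A := cone_minus_mirrors G in Ax *.
have ggR (y : 'rV[RR]_n) : y *m rmx g *m rmx g = y.
  by rewrite -mulmxA -map_mxM gg map_mx1 mulmx1.
have gA y : A y -> A (y *m rmx g).
  move=> [yy yr]; split; first by rewrite bR_isometry.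
  move=> v vr; rewrite -(bR_isometry _ _ gG) ggR -map_mxM.
  by apply: yr; exact: root_vec_isometry.
exists (connected_component A x); split; first by exists x.
set P := connected_component A x; pose f (y : 'rV[RR]_n) := y *m rmx g.
have Pf : f @` P `<=` P.
  apply: connected_component_max.
  - by exists x => //; exact: connected_component_refl.
  - by move=> _ [y /connected_component_sub Ay <-]; exact: gA.
  apply: connected_continuous_connected; first exact: component_connected.
  by apply: continuous_subspaceT; exact: continuous_mulmxr.
apply/seteqP; split=> // y Py; exists (f y); last exact: ggR.
by apply: Pf; exists y.
Qed.

Lemma scalemx_inj m n (c : int) : c != 0 ->
  injective (fun A : 'M[int]_(m, n) => c *: A).
Proof.
move=> c0 A B /matrixP AB; apply/matrixP => i j.
by have := AB i j; rewrite !mxE => /(mulfI c0).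
Qed.

(* The rows of [B] span a sublattice K = E6(2) of [G], primitive because of [C].
   As [D] computes the pairings with K in the dual basis, [1 - D B] is the identity
   on the orthogonal complement of K and -1 on K, and [h] doubles the projection
   onto that complement; [S] witnesses that 2 h maps the dual lattice into the
   lattice. *)
Section CoinvariantE6.
Variables (n : nat) (G S : 'M[int]_n) (B : 'M[int]_(6, n)) (D C : 'M[int]_(n, 6)).
Hypotheses (symG : G^T = G) (detG : \det G != 0) (DE : D *m E6 = G *m B^T).
Hypotheses (BD : B *m D = 2%:M) (BC : B *m C = 1%:M).

Let h := 2%:M - D *m B.
Let g := 1%:M - D *m B.

Hypothesis GS : G *m S = 2 *: h.

Let symE6 : E6^T = E6. Proof. exact: cartan_sym. Qed.

Lemma coinvariant_pairing : B *m G = E6 *m D^T.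
Proof. by rewrite -[LHS]trmxK trmx_mul symG -DE trmx_mul symE6. Qed.

Lemma coinvariant_gram : B *m G *m B^T = 2 *: E6.
Proof. by rewrite coinvariant_pairing -mulmxA -trmx_mul BD tr_scalar_mx mul_mx_scalar. Qed.

Let DBDB : D *m B *m (D *m B) = D *m B + D *m B.
Proof. by rewrite mulmxA -(mulmxA D) BD mul_mx_scalar -scalemxAl scaler_nat mulr2n. Qed.

Lemma coinvariant_isometry : isometry G g.
Proof.
have GDB : G *m (D *m B)^T = D *m B *m G.
  by rewrite trmx_mul mulmxA -DE -!mulmxA coinvariant_pairing.
rewrite /Defs.isometry /g linearB /= trmx1 -mulmxA mulmxBr mulmx1 GDB.
rewrite mulmxBl mul1mx mulmxBr (mulmxA (D *m B)) DBDB mulmxDl.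
by rewrite opprB addrK subrK.
Qed.

Lemma coinvariant_involution : g *m g = 1%:M.
Proof. by rewrite /g mulmxBr mulmx1 mulmxBl mul1mx DBDB opprB addrK subrK. Qed.

Lemma coinvariant_invariant : h *m g = h.
Proof.
rewrite /h /g mulmxBr mulmx1 mulmxBl mul_scalar_mx DBDB scaler_nat mulr2n.
by rewrite subrr subr0.
Qed.

(* A vector orthogonal to the invariant sublattice lies in K = E6(2). *)
Lemma coinvariant_norm (v : 'rV[int]_n) : h *m G *m v^T = 0 -> (4 %| bZ G v v)%Z.
Proof.
move=> hv; have hG_sym : (h *m G)^T = h *m G.
  rewrite /h mulmxBl mul_scalar_mx -mulmxA coinvariant_pairing linearB /= linearZ /=.
  by rewrite symG !trmx_mul trmxK symE6 mulmxA.
have vh : v *m h = 0.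
  have vhG : v *m h *m G = 0.
    by have := congr1 trmx hv; rewrite trmx_mul trmxK hG_sym trmx0 mulmxA.
  have := congr1 (mulmx^~ (\adj G)) vhG.
  rewrite -(mulmxA (v *m h)) mul_mx_adj mul_mx_scalar mul0mx => adjE.
  by apply: (scalemx_inj detG); rewrite /= adjE scaler0.
have v2 : 2 *: v = v *m D *m B.
  by move/eqP: vh; rewrite /h mulmxBr mul_mx_scalar subr_eq0 mulmxA => /eqP.
have vDC : v *m D = 2 *: (v *m C).
  by rewrite scalemxAl v2 -mulmxA BC mulmx1.
have vE : v = v *m C *m B.
  by apply: (@scalemx_inj _ _ 2) => //=; rewrite v2 vDC -scalemxAl.
have -> : bZ G v v = 2 * bZ E6 (v *m C) (v *m C).
  rewrite {1 2}vE /bZ trmx_mul -!mulmxA (mulmxA B) (mulmxA (B *m G)) coinvariant_gram.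
  by rewrite -scalemxAl -!scalemxAr mxE !mulmxA.
have /dvdzP[q ->] : (2 %| bZ E6 (v *m C) (v *m C))%Z by exact: cartan_even.
by apply/dvdzP; exists q; ring.
Qed.

Lemma coinvariant_Z3_reversing : Z3_reversing G g.
Proof.
have hE : h = g + 1%:M by rewrite /h /g addrAC -raddfD.
move=> x xd x3; have := Z3_part_integral GS xd x3.
by rewrite hE (map_mxD _ g 1%:M) map_mx1 mulmxDr mulmx1.
Qed.

Lemma achiral_coinvariant_E6 (u : 'rV[int]_n) : bZ G (u *m h) (u *m h) < 0 -> achiral G.
Proof.
move=> /exists_generic_point[y yy yv]; exists g; split.
- exact: coinvariant_isometry.
- exact: coinvariant_Z3_reversing.
apply: (involution_direct (x := y *m rmx h) detG coinvariant_isometry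
  coinvariant_involution); first by rewrite -mulmxA -map_mxM coinvariant_invariant.
split=> // v v_root; apply: yv; apply/eqP => /coinvariant_norm.
by case: v_root => [->|[-> _]].
Qed.

End CoinvariantE6.

Definition has_coinvariant_E6 n (G : 'M[int]_n) : Prop :=
  exists (S : 'M[int]_n) (B : 'M[int]_(6, n)) (D C : 'M[int]_(n, 6)) (u : 'rV[int]_n),
  [/\ G^T = G /\ \det G != 0, D *m E6 = G *m B^T, B *m D = 2%:M /\ B *m C = 1%:M,
    G *m S = 2 *: (2%:M - D *m B) &
    bZ G (u *m (2%:M - D *m B)) (u *m (2%:M - D *m B)) < 0].

Lemma coinvariant_E6_achiral n (G : 'M[int]_n) : has_coinvariant_E6 G -> achiral G.
Proof.
move=> [S [B [D [C [u [[symG detG] DE [BD BC] GS u_neg]]]]]].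
exact: (achiral_coinvariant_E6 symG detG DE BD BC GS u_neg).
Qed.

Lemma coinvariant_E6_osum m n (G : 'M[int]_m) (N T : 'M[int]_n) :
  N^T = N -> N *m T = 4%:M -> has_coinvariant_E6 G -> has_coinvariant_E6 (osum G N).
Proof.
move=> symN NT [S [B [D [C [u [[symG detG] DE [BD BC] GS u_neg]]]]]].
have detN : \det N != 0.
  have := congr1 determinant NT; rewrite det_mulmx det_scalar.
  by apply: contra_eq_neq => ->; rewrite mul0r eq_sym expf_neq0.
exists (osum S T), (row_mx B 0), (col_mx D 0), (col_mx C 0), (row_mx u 0).
have -> : 2%:M - col_mx D (0 : 'M[int]_(n, 6)) *m row_mx B 0 = osum (2%:M - D *m B) 2%:M.
  rewrite mul_col_row !mul0mx mulmx0 scalar_mx_block opp_block_mx add_block_mx.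
  by rewrite !oppr0 !addr0.
split.
- by rewrite osum_sym // /osum det_ublock mulf_neq0.
- by rewrite mul_col_mx DE tr_row_mx mul_block_col !mul0mx !trmx0 !mulmx0 !addr0.
- by rewrite !mul_row_col !mulmx0 !addr0.
- rewrite /osum mulmx_block !mulmx0 !mul0mx !addr0 add0r scale_block_mx !scaler0 GS NT.
  by congr (block_mx _ _ _ _); rewrite scale_scalar_mx.
by rewrite /osum mul_row_block !mul0mx !mulmx0 !addr0 bZ_osum linear0l addr0.
Qed.

Definition E6_inv3 : seq (seq int) :=
  [:: [:: 4; 3; 5; 6; 4; 2]; [:: 3; 6; 6; 9; 6; 3]; [:: 5; 6; 10; 12; 8; 4];
      [:: 6; 9; 12; 18; 12; 6]; [:: 4; 6; 8; 12; 10; 5]; [:: 2; 3; 4; 6; 5; 4]].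

Definition divseqmx c m n s := mkseqmx m n (fun i j => divz (entry s i j) c).

(* [B] is a basis of a sublattice E6(2) of [G], [C] a dual system showing that it
   is primitive, [Gi] is 12 times the inverse of [G]; [uh] is twice the projection
   of the timelike vector e - f. *)
Definition E6_certificate n (G Gi B C : seq (seq int)) : bool :=
  let gramE6 := cartanseqmx 6 [:: (0, 2); (2, 3); (3, 4); (4, 5); (1, 3)]%N in
  let GB := mulseqmx n n 6 G (trseqmx n 6 B) in
  let D := divseqmx 3 n 6 (mulseqmx n 6 6 GB E6_inv3) in
  let h := subseqmx n n (scalarseqmx 2 n) (mulseqmx n 6 n D B) in
  let S := divseqmx 6 n n (mulseqmx n n n Gi h) in
  let uh := mulseqmx 1 n n [:: [:: 1; -1]] h in
  [&& trseqmx n n G == mkseqmx n n (entry G), mulseqmx n n n G Gi == scalarseqmx 12 n,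
      mulseqmx n 6 6 D gramE6 == GB, mulseqmx 6 n 6 B D == scalarseqmx 2 6,
      mulseqmx 6 n 6 B (trseqmx n 6 C) == scalarseqmx 1 6,
      mulseqmx n n n G S == scaleseqmx 2 n n h
    & entry (mulseqmx 1 n 1 (mulseqmx 1 n n uh G) (trseqmx n 1 uh)) 0 0 < 0].

Lemma coinvariant_E6_of_certificate n G Gi B C :
  E6_certificate n G Gi B C -> has_coinvariant_E6 (seqmx n n G).
Proof.
rewrite /E6_certificate; set GB := mulseqmx n n 6 G _; set D := divseqmx 3 n 6 _.
set h := subseqmx n n _ _; set S := divseqmx 6 n n _; set uh := mulseqmx 1 n n _ h.
case/and5P=> /eqP symG /eqP GGi /eqP DE /eqP BD /and3P[/eqP BC /eqP GS neg].
have hE : 2%:M - seqmx n 6 D *m seqmx 6 n B = seqmx n n h.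
  by rewrite seqmx_scalar seqmxM seqmxB.
exists (seqmx n n S), (seqmx 6 n B), (seqmx n 6 D), (seqmx n 6 (trseqmx n 6 C)).
exists (seqmx 1 n [:: [:: 1; -1]]); rewrite hE; split.
- split; first by rewrite seqmx_tr symG seqmx_mkseqmx.
  have := congr1 (fun s => \det (seqmx n n s)) GGi.
  rewrite -seqmxM -seqmx_scalar det_mulmx det_scalar.
  by apply: contra_eq_neq => ->; rewrite mul0r eq_sym expf_neq0.
- by rewrite /E6 seqmx_cartan seqmxM seqmx_tr seqmxM -/GB -DE.
- by rewrite !seqmxM BD BC !seqmx_scalar.
- by rewrite seqmxM GS seqmxZ.
by rewrite /bZ !seqmxM seqmx_tr !seqmxM mxE.
Qed.

Definition U_inv12 : seq (seq int) := [:: [:: 0; 12]; [:: 12; 0]].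
Definition U2_inv12 : seq (seq int) := [:: [:: 0; 6]; [:: 6; 0]].
Definition A2_inv12 : seq (seq int) := [:: [:: 8; 4]; [:: 4; 8]].
Definition D4_inv12 : seq (seq int) := scaleseqmx 6 4 4 D4_inv2.
Definition E8_inv12 : seq (seq int) := scaleseqmx 12 8 8 E8_inv.
Definition E8_2_inv12 : seq (seq int) := scaleseqmx 6 8 8 E8_inv.
Definition E6_2_inv12 : seq (seq int) := scaleseqmx 2 6 6 E6_inv3.

(* These bases were found by writing the lattice as an overlattice of M + E6(2)
   with M 2-elementary (e.g. U + A2 + 2 E8 is the index 3 overlattice of U + 3 E6
   with its symmetry exchanging two copies of E6) and transporting E6(2) along an
   isometry. *)
Definition basis_U2_A2_D4 : seq (seq int) :=
  [:: [:: -2; 2; -2; 0; 1; -2; -1; -2];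
      [:: 1; -1; 1; 0; -2; -2; -1; 0];
      [:: 0; 0; 0; 1; 0; 1; 1; 1];
      [:: 0; -1; 0; -1; 0; 1; 0; 0];
      [:: 1; 1; 0; 0; 0; 0; 0; 0];
      [:: -1; 0; 0; 0; 1; 0; 1; 0]].
Definition dual_U2_A2_D4 : seq (seq int) :=
  [:: [:: 1; -1; -1; 1; 0; 0; 1; -2];
      [:: 0; 0; 0; 0; -1; 0; 1; -1];
      [:: 0; 0; -1; 0; -1; 0; 1; 0];
      [:: 0; 0; -1; -1; -1; 0; 1; 0];
      [:: 0; 1; 0; -1; -1; 0; 1; 0];
      [:: -1; 1; 1; -1; -1; 0; 1; 0]].

Definition basis_U2_A2_E8 : seq (seq int) :=
  [:: [:: -2; 2; -2; 0; 0; 1; -1; -2; -2; 0; 0; 0];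
      [:: 1; -1; 1; 0; 0; -2; -1; -2; 0; 0; 0; 0];
      [:: 0; 0; 0; 1; 0; 0; 1; 1; 1; 0; 0; 0];
      [:: 0; -1; 0; -1; 0; 0; 0; 1; 0; 0; 0; 0];
      [:: 1; 1; 0; 0; 0; 0; 0; 0; 0; 0; 0; 0];
      [:: -1; 0; 0; 0; 0; 1; 1; 0; 0; 0; 0; 0]].
Definition dual_U2_A2_E8 : seq (seq int) :=
  [:: [:: 1; -1; -1; 1; 0; 0; 1; 0; -2; 0; 0; 0];
      [:: 0; 0; 0; 0; 0; -1; 1; 0; -1; 0; 0; 0];
      [:: 0; 0; -1; 0; 0; -1; 1; 0; 0; 0; 0; 0];
      [:: 0; 0; -1; -1; 0; -1; 1; 0; 0; 0; 0; 0];
      [:: 0; 1; 0; -1; 0; -1; 1; 0; 0; 0; 0; 0];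
      [:: -1; 1; 1; -1; 0; -1; 1; 0; 0; 0; 0; 0]].

Definition basis_U_A2_D4_D4 : seq (seq int) :=
  [:: [:: 6; -5; 4; 2; -2; 0; 1; 2; -2; -1; 1; -3];
      [:: 6; -6; 4; 2; -2; 1; 2; 3; -1; 1; 3; -1];
      [:: 0; -1; 0; 0; -1; -1; 0; -1; 0; 0; 1; 0];
      [:: -6; 7; -4; -2; 3; 0; -2; -2; 1; -1; -3; 2];
      [:: 0; -1; 0; 0; -1; 0; 0; 0; 0; 1; 0; 0];
      [:: 0; 1; 0; 0; 1; 1; 1; 0; 1; 0; 0; 0]].
Definition dual_U_A2_D4_D4 : seq (seq int) :=
  [:: [:: 0; 0; 0; -1; -1; 1; 0; 0; 0; -1; 0; 0];
      [:: 0; 0; 0; 0; -1; 1; 0; 0; 0; -1; 0; 1];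
      [:: 0; 0; 0; 1; -1; 1; 0; -1; 0; -1; 0; 1];
      [:: 1; 1; 0; 0; -1; 1; 0; -1; -1; 0; 0; 1];
      [:: 0; 0; 1; 0; -1; 1; 0; -1; 0; 0; -1; 1];
      [:: 0; 0; 0; 1; 0; 1; 0; -1; 0; 0; 0; 0]].

Definition basis_U_A2_E8_2 : seq (seq int) :=
  [:: [:: 0; 0; 0; 0; 0; -1; -1; -2; -2; -2; -1; 0];
      [:: 0; 0; 0; 0; -2; -3; -4; -6; -5; -4; -3; -2];
      [:: -6; 6; -4; -2; 3; -1; 2; 2; 3; 4; 2; 0];
      [:: 6; -6; 4; 2; -2; 3; 0; 1; 0; -1; 0; 1];
      [:: 0; 0; 0; 0; 0; 0; 0; 1; 0; 0; 0; 0];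
      [:: 0; 0; 0; 0; 0; 0; 0; 0; 1; 0; 0; 0]].
Definition dual_U_A2_E8_2 : seq (seq int) :=
  [:: [:: 0; 0; 0; -1; 0; 0; -1; 0; 0; 0; 0; 2];
      [:: 0; 0; 0; 0; 0; 0; -1; 0; 0; 0; 1; 0];
      [:: 0; 0; -1; 0; 0; 1; -2; 0; 0; 0; 1; 1];
      [:: 0; 0; 0; 0; 1; 1; -2; 0; 0; 0; 1; 0];
      [:: 0; 0; 0; -1; 0; 0; -2; 1; 0; 0; 0; 1];
      [:: 0; 0; 0; 1; 0; -1; -1; 0; 1; 0; 0; 1]].

Definition basis_U2_A2_E8_2 : seq (seq int) :=
  [:: [:: 0; 0; 0; 0; -2; -3; -4; -6; -5; -4; -3; -2];
      [:: 12; -12; -8; 8; 1; 4; 0; -1; -7; -4; -1; 0];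
      [:: -3; 3; 2; -2; 0; -1; 0; 0; 2; 1; 1; 1];
      [:: -3; 3; 2; -2; 0; 0; 1; 2; 3; 2; 0; 0];
      [:: -3; 3; 2; -2; 0; -1; 0; 1; 2; 1; 1; 0];
      [:: 6; -6; -4; 4; 1; 3; 2; 1; -2; -1; 0; 0]].
Definition dual_U2_A2_E8_2 : seq (seq int) :=
  [:: [:: 0; 0; 0; -1; 1; -1; 1; 1; -1; -1; -1; 1];
      [:: 0; 0; 0; 0; -2; 0; 0; 1; 0; -1; 0; 1];
      [:: 0; 1; -1; 0; -1; 1; 0; 0; 1; -2; 0; 1];
      [:: 0; 0; 0; 0; -1; 0; 0; 1; 1; -2; -1; 1];
      [:: 0; 0; 0; -1; 1; 0; 0; 1; 0; -2; 0; 0];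
      [:: 0; 1; -1; 0; 0; 0; 1; 0; 0; -1; 0; 0]].

Definition basis_U_A2_D4_E8 : seq (seq int) :=
  [:: [:: -1; -1; 0; 0; 0; 0; 0; 0; 2; 3; 4; 6; 5; 4; 3; 2];
      [:: -1; 1; 1; 1; 0; 0; 0; 0; 1; 0; 1; 1; 1; 2; 1; 0];
      [:: -1; 2; 1; 1; 0; 0; 0; -1; -2; -4; -4; -6; -4; -3; -2; -1];
      [:: 0; 0; 0; -1; 0; 0; 0; 0; 1; 1; 2; 2; 1; 0; 0; 0];
      [:: 1; -1; -1; 0; 0; 0; 0; 0; 0; 1; -1; 0; 0; 0; 0; 0];
      [:: 1; -1; 0; 0; 0; 0; 0; 1; -2; -1; -2; -3; -3; -2; -1; 0]].
Definition dual_U_A2_D4_E8 : seq (seq int) :=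
  [:: [:: 0; -1; 1; 0; 0; 0; 0; -1; 0; 0; 0; 0; 0; 0; 0; 0];
      [:: 0; 0; 1; 1; 0; 0; 0; 0; 0; 1; 0; 0; 0; 0; -1; 0];
      [:: 0; -1; 2; 0; 0; 0; 0; -1; 0; 0; -1; 1; 0; 0; -1; 0];
      [:: 0; 0; 1; 1; 0; 0; 0; -1; 0; 1; 0; 1; -1; -1; 0; 0];
      [:: 0; 0; 1; 0; 0; 0; 0; -1; 0; 1; -1; 1; -1; 0; 0; 0];
      [:: 0; -1; 0; 1; 0; 0; 0; -1; 0; 0; 1; 0; -1; 0; 0; 0]].

Definition basis_U_A2_E8_E8 : seq (seq int) :=
  [:: [:: 0; 0; 0; 0; 0; 0; 0; 0; 0; 0; 0; 0; -1; -1; -2; -3; -3; -1; 0; 0];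
      [:: -2; 3; 2; 1; 1; 0; 1; 0; 0; 0; 0; 0; 1; 0; 2; 1; 1; 1; 1; 2];
      [:: -1; 1; 0; 0; 1; 0; 1; 0; 0; 0; 0; 0; 1; 0; 2; 1; 1; 0; 0; 0];
      [:: 2; -2; -1; 0; -1; 0; -1; 0; 0; 0; 0; 0; -1; 0; -2; 0; 0; 0; 0; -1];
      [:: 1; -1; -1; -1; -1; 0; -1; 0; 0; 0; 0; 0; 0; 1; 1; 1; 1; 1; 0; 0];
      [:: -1; 1; 1; 0; 1; 0; 1; 0; 0; 0; 0; 0; 1; 0; 0; 0; 0; 0; 0; 0]].
Definition dual_U_A2_E8_E8 : seq (seq int) :=
  [:: [:: 0; 0; 0; -1; 0; 0; 0; 0; 0; 0; 0; 0; 0; -1; 0; 0; 0; 0; 1; 0];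
      [:: 0; 0; 0; 0; 0; 0; 0; 0; 0; 0; 0; 0; 0; 0; 0; 0; 0; 0; 1; 0];
      [:: 0; 0; -1; 0; 1; 0; 0; 0; 0; 0; 0; 0; 0; 0; 0; 0; 0; 0; 1; 0];
      [:: 1; 0; 0; 0; 1; 0; 0; 0; 0; 0; 0; 0; 0; 0; 0; 0; 0; 0; 1; 0];
      [:: 0; 0; 0; -1; 0; 0; 0; 0; 0; 0; 0; 0; 0; 0; 0; 0; 0; 0; 1; 0];
      [:: 1; 0; 1; -1; 1; 0; 0; 0; 0; 0; 0; 0; 0; 0; 0; 0; 0; 0; 0; 0]].

Definition basis_E6 : seq (seq int) :=
  [seq 0 :: 0 :: r | r <- scalarseqmx 1 6].

Definition seqmxE := (seqmx_U, seqmx_cartan, seqmx_scale2, seqmx_osum).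

Lemma coinvariant_E6_U_E6_2 : has_coinvariant_E6 (osum U (scale2 E6)).
Proof.
rewrite /E6 !seqmxE; apply: (@coinvariant_E6_of_certificate _ _
  (osumseqmx 2 6 U_inv12 E6_2_inv12) basis_E6 basis_E6).
by vm_compute.
Qed.

Lemma coinvariant_E6_U2_E6_2 : has_coinvariant_E6 (osum (scale2 U) (scale2 E6)).
Proof.
rewrite /E6 !seqmxE; apply: (@coinvariant_E6_of_certificate _ _
  (osumseqmx 2 6 U2_inv12 E6_2_inv12) basis_E6 basis_E6).
by vm_compute.
Qed.

Lemma coinvariant_E6_U2_A2_D4 : has_coinvariant_E6 (osum (osum (scale2 U) A2) D4).
Proof.
rewrite /A2 /D4 !seqmxE; apply: (@coinvariant_E6_of_certificate _ _
  (osumseqmx 4 4 (osumseqmx 2 2 U2_inv12 A2_inv12) D4_inv12)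
  basis_U2_A2_D4 dual_U2_A2_D4).
by vm_compute.
Qed.

Lemma coinvariant_E6_U2_A2_E8 : has_coinvariant_E6 (osum (osum (scale2 U) A2) E8).
Proof.
rewrite /A2 /E8 !seqmxE; apply: (@coinvariant_E6_of_certificate _ _
  (osumseqmx 4 8 (osumseqmx 2 2 U2_inv12 A2_inv12) E8_inv12)
  basis_U2_A2_E8 dual_U2_A2_E8).
by vm_compute.
Qed.

Lemma coinvariant_E6_U_A2_D4_D4 : has_coinvariant_E6 (osum (osum (osum U A2) D4) D4).
Proof.
rewrite /A2 /D4 !seqmxE; apply: (@coinvariant_E6_of_certificate _ _
  (osumseqmx 8 4 (osumseqmx 4 4 (osumseqmx 2 2 U_inv12 A2_inv12) D4_inv12) D4_inv12)
  basis_U_A2_D4_D4 dual_U_A2_D4_D4).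
by vm_compute.
Qed.

Lemma coinvariant_E6_U_A2_E8_2 : has_coinvariant_E6 (osum (osum U A2) (scale2 E8)).
Proof.
rewrite /A2 /E8 !seqmxE; apply: (@coinvariant_E6_of_certificate _ _
  (osumseqmx 4 8 (osumseqmx 2 2 U_inv12 A2_inv12) E8_2_inv12)
  basis_U_A2_E8_2 dual_U_A2_E8_2).
by vm_compute.
Qed.

Lemma coinvariant_E6_U2_A2_E8_2 : has_coinvariant_E6 (osum (osum (scale2 U) A2) (scale2 E8)).
Proof.
rewrite /A2 /E8 !seqmxE; apply: (@coinvariant_E6_of_certificate _ _
  (osumseqmx 4 8 (osumseqmx 2 2 U2_inv12 A2_inv12) E8_2_inv12)
  basis_U2_A2_E8_2 dual_U2_A2_E8_2).
by vm_compute.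
Qed.

Lemma coinvariant_E6_U_A2_D4_E8 : has_coinvariant_E6 (osum (osum (osum U A2) D4) E8).
Proof.
rewrite /A2 /D4 /E8 !seqmxE; apply: (@coinvariant_E6_of_certificate _ _
  (osumseqmx 8 8 (osumseqmx 4 4 (osumseqmx 2 2 U_inv12 A2_inv12) D4_inv12) E8_inv12)
  basis_U_A2_D4_E8 dual_U_A2_D4_E8).
by vm_compute.
Qed.

Lemma coinvariant_E6_U_A2_E8_E8 : has_coinvariant_E6 (osum (osum (osum U A2) E8) E8).
Proof.
rewrite /A2 /E8 !seqmxE; apply: (@coinvariant_E6_of_certificate _ _
  (osumseqmx 12 8 (osumseqmx 4 8 (osumseqmx 2 2 U_inv12 A2_inv12) E8_inv12) E8_inv12)
  basis_U_A2_E8_E8 dual_U_A2_E8_E8).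
by vm_compute.
Qed.

Lemma coinvariant_E6_osum_D4 n (G : 'M[int]_n) :
  has_coinvariant_E6 G -> has_coinvariant_E6 (osum G D4).
Proof.
apply: (coinvariant_E6_osum (T := 2 *: seqmx 4 4 D4_inv2)); first exact: cartan_sym.
by rewrite -scalemxAr D4_mul_inv2 scale_scalar_mx.
Qed.

Lemma coinvariant_E6_osum_E8 n (G : 'M[int]_n) :
  has_coinvariant_E6 G -> has_coinvariant_E6 (osum G E8).
Proof.
apply: (coinvariant_E6_osum (T := 4 *: seqmx 8 8 E8_inv)); first exact: cartan_sym.
by rewrite -scalemxAr E8_mul_inv scale_scalar_mx.
Qed.

Theorem theorem3p1 :
  (chiral (osum (U) (A2)) /\
   chiral (osum (scale2 U) (A2)) /\
   chiral (osum (osum (U) (A2)) (D4)) /\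
   chiral (osum (osum (U) (A2)) (E8))) /\
  (achiral (osum (osum (scale2 U) (A2)) (D4)) /\
   achiral (osum (U) (scale2 E6)) /\
   achiral (osum (scale2 U) (scale2 E6)) /\
   achiral (osum (osum (scale2 U) (A2)) (E8)) /\
   achiral (osum (osum (osum (U) (A2)) (D4)) (D4)) /\
   achiral (osum (osum (osum (scale2 U) (A2)) (D4)) (D4)) /\
   achiral (osum (osum (U) (A2)) (scale2 E8)) /\
   achiral (osum (osum (scale2 U) (A2)) (scale2 E8)) /\
   achiral (osum (osum (osum (U) (A2)) (D4)) (E8)) /\
   achiral (osum (osum (osum (scale2 U) (A2)) (D4)) (E8)) /\
   achiral (osum (osum (osum (U) (A2)) (E8)) (E8)) /\
   achiral (osum (osum (osum (scale2 U) (A2)) (E8)) (E8))).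
Proof.
split.
  split; first exact: chiral_U_A2.
  split; first exact: chiral_U2_A2.
  by split; [exact: chiral_U_A2_D4 | exact: chiral_U_A2_E8].
split; first exact/coinvariant_E6_achiral/coinvariant_E6_U2_A2_D4.
split; first exact/coinvariant_E6_achiral/coinvariant_E6_U_E6_2.
split; first exact/coinvariant_E6_achiral/coinvariant_E6_U2_E6_2.
split; first exact/coinvariant_E6_achiral/coinvariant_E6_U2_A2_E8.
split; first exact/coinvariant_E6_achiral/coinvariant_E6_U_A2_D4_D4.
split; first exact/coinvariant_E6_achiral/coinvariant_E6_osum_D4/coinvariant_E6_U2_A2_D4.
split; first exact/coinvariant_E6_achiral/coinvariant_E6_U_A2_E8_2.
split; first exact/coinvariant_E6_achiral/coinvariant_E6_U2_A2_E8_2.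
split; first exact/coinvariant_E6_achiral/coinvariant_E6_U_A2_D4_E8.
split; first exact/coinvariant_E6_achiral/coinvariant_E6_osum_E8/coinvariant_E6_U2_A2_D4.
split; first exact/coinvariant_E6_achiral/coinvariant_E6_U_A2_E8_E8.
exact/coinvariant_E6_achiral/coinvariant_E6_osum_E8/coinvariant_E6_U2_A2_E8.
Qed.
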